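(* Let $\epsilon>0$ and $c>0$ be constants. For each $n$ (in an infinite set of positive integers) let $G=G^{(n)}$ be a $d$-regular, $\lambda$-edge-connected graph on $n$ vertices, where $d=d(n)$ and $\lambda=\lambda(n)$ satisfy $d\ge\lambda\ge cn$ (i.e. $d \geq \lambda=\Omega(n)$). Let $p=(2+\epsilon)\frac{\log n}{d}$. If each edge of the random subgraph $G_p$ is colored independently and uniformly at random from the set $[n-1]$, then asymptotically almost surely $G_p$ contains a rainbow spanning tree; that is, the probability that $G_p$ contains a rainbow spanning tree tends to $1$ as $n\to\infty$.
   Context: All graphs are finite and simple; $\log$ is the natural logarithm; $[m]=\{1,\dots,m\}$. For a graph $G$ and $0<p<1$ ($p$ may depend on $n$), $G_p$ denotes the random spanning subgraph of $G$ (with vertex set $V(G)$) obtained by keeping each edge of $G$ independently with probability $p$. Statements are asymptotic in $n$, so only large $n$ (for which $0<p<1$) matters. A subgraph of an edge-colored graph (the coloring need not be proper) is rainbow if all its edges have distinct colors; a rainbow spanning tree is a spanning tree that is rainbow. *)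

(* Defs.v *)
From HB Require Import structures.
From mathcomp Require Import all_boot all_order all_algebra.
From mathcomp Require Import all_classical all_reals all_analysis.

Set Implicit Arguments.
Unset Strict Implicit.
Unset Printing Implicit Defensive.

Import Order.TTheory GRing.Theory Num.Theory.
Local Open Scope ring_scope.

Section Graphs.
Variable V : finType.

Record sgraph := SGraph {
  edges : {set {set V}};
  edges_card2 : [forall e in edges, #|e| == 2%N] }.

HB.instance Definition _ := [isSub for edges].
HB.instance Definition _ := [Finite of sgraph by <:].

Implicit Types G H T : sgraph.

(* Irreflexive: [set x; x] has cardinal 1, so it is never an edge. *)
Definition adj G : rel V := fun x y => [set x; y]%SET \in edges G.

Definition regular G (d : nat) : Prop :=
  forall x : V, #|[set y | adj G x y]%SET| = d.

Definition graph_connected G : Prop := forall x y : V, connect (adj G) x y.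

(* [:: x; y] is a ucycle for every edge xy; genuine cycles have length >= 3. *)
Definition acyclic G : Prop :=
  forall c : seq V, ucycle (adj G) c -> (size c < 3)%N.

Fact del_edges_subproof G (F : {set {set V}}) :
  [forall e in edges G :\: F, #|e| == 2%N].
Proof.
apply/forall_inP => e; rewrite inE => /andP[_ eG].
exact: (forall_inP (edges_card2 G)).
Qed.

Definition del_edges G (F : {set {set V}}) : sgraph :=
  SGraph (del_edges_subproof G F).

Definition edge_connected G (k : nat) : Prop :=
  forall F : {set {set V}},
    F \subset edges G -> (#|F| < k)%N -> graph_connected (del_edges G F).

Definition subgraph H G : bool := edges H \subset edges G.

Definition spanning_tree T G : Prop :=
  [/\ subgraph T G, graph_connected T & acyclic T].

Definition coloring H (k : nat) := {ffun {e | e \in edges H} -> 'I_k}.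

Definition rainbow H (k : nat) (f : coloring H k) T : Prop :=
  {in [pred e : {e | e \in edges H} | val e \in edges T] &, injective f}.

Definition has_rainbow_spanning_tree H (k : nat) (f : coloring H k) : Prop :=
  exists2 T : sgraph, spanning_tree T H & rainbow f T.

Variable R : realType.

(* The probability that G_p is H. *)
Definition Gp_prob G (p : R) H : R :=
  if subgraph H G then \prod_(e in edges G) (if e \in edges H then p else 1 - p)
  else 0.

Definition coloring_prob H (k : nat) (f : coloring H k) : R :=
  \prod_(e : {e | e \in edges H}) k%:R^-1.

(* The probability that G_p, with its edges then colored independently and
   uniformly from k colors, satisfies Q. *)
Definition Pr_colored_Gp G (p : R) (k : nat)
    (Q : forall H, coloring H k -> Prop) : R :=
  \sum_(H : sgraph) Gp_prob G p H *
    \sum_(f : coloring H k | `[< Q H f >]) coloring_prob f.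

Lemma coloring_prob_sum1 H (k : nat) :
  (0 < k)%N -> \sum_(f : coloring H k) coloring_prob f = 1.
Proof.
move=> k0; rewrite /coloring_prob -(bigA_distr_bigA (fun _ _ => k%:R^-1)) /=.
apply: big1 => e _; rewrite sumr_const card_ord -[LHS]mulr_natl divff //.
by rewrite pnatr_eq0 -lt0n.
Qed.

Lemma Gp_prob_sum1 G (p : R) : \sum_(H : sgraph) Gp_prob G p H = 1.
Proof.
pose E := edges G.
pose F e : R := if e \in E then p else 0.
pose F' e : R := if e \in E then 1 - p else 1.
pose h (A : {set {set V}}) := del_edges G (E :\: A).
have hE (A : {set {set V}}) : A \subset E -> edges (h A) = A.
  by move=> AE; rewrite /= finset.setDDr finset.setDv finset.set0U;
     apply/finset.setIidPr.
transitivity (\prod_e (F e + F' e)); last first.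
  apply: big1 => e _; rewrite /F /F'; case: ifP => _; last by rewrite add0r.
  by rewrite addrC subrK.
rewrite bigA_distr /= (bigID (fun A : {set {set V}} => A \subset E)) /=.
rewrite [X in _ + X]big1 ?addr0 => [|A]; last first.
  move=> /subsetPn[e eA eE].
  by rewrite (bigD1 e) //= eA /F (negbTE eE) mul0r.
rewrite [RHS](reindex edges) /=; last first.
  exists h => [H HG|A AG]; last exact: hE.
  by apply: val_inj; apply: hE.
rewrite /Gp_prob -big_mkcond /=; apply: eq_bigr => H HG.
rewrite big_mkcond; apply: eq_bigr => e _; rewrite /F /F' -/E.
case: ifPn => // eE; rewrite ifF //; apply: contraNF eE.
by move=> eH; exact: (fintype.subsetP HG).
Qed.

End Graphs.

(* Main.v *)
(* Colors and edges are matched by Rado's theorem in the graphic matroid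
   (vectors over F_2): a rainbow spanning tree exists unless some set J of m
   colors spans edges of rank less than m.  Two union bounds exclude this.
   If m is at most (1 - 1/D) n, take a forest F of fewer than m edges spanning
   the edges colored in J: no edge of G joining two components of F has a color
   in J.  Demanding that the edges of F be present compensates for the number
   of forests, and the number of edges between components is bounded below by
   regularity for small m and by edge-connectivity otherwise.
   If m is larger, let P be the partition into components of the edges colored
   in J: the edges between the parts carry at most min(|P|, n/D) colors.
   Exhibiting one edge of each color costs only a factor D^|P|, so the
   probability is at most the product over the parts A of
   D n^(- gam cut(A) / d) with gam > 1.  The sum over all P is then controlled
   by the sum Z of these factors over all proper subsets A of V, and Z tends to
   0: sets with cut at most b are, up to O(b/d) vertices, among a bounded number
   of sets (d being linear in n), and each vertex moved costs about d edges. *)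

Require Import Defs.
From mathcomp Require Import all_boot all_order all_algebra.
From mathcomp Require Import zify.
Import Order.TTheory GRing.Theory Num.Theory.

Set Implicit Arguments.
Unset Strict Implicit.
Unset Printing Implicit Defensive.

Local Open Scope ring_scope.

(** * Rado's theorem *)

Section FamilySpan.
Variables (K : fieldType) (vT : vectType K) (T : finType) (phi : T -> vT).
Implicit Types S F : {set T}.

Definition fspan S : {vspace vT} := (\sum_(x in S) <[phi x]>)%VS.

Lemma mem_fspan S x : x \in S -> phi x \in fspan S.
Proof. by move=> xS; rewrite /fspan memvE (sumv_sup x). Qed.

Lemma fspan_subP S (U : {vspace vT}) :
  reflect {in S, forall x, phi x \in U} (fspan S <= U)%VS.
Proof.
apply: (iffP subv_sumP) => [h x /h|h x /h]; by rewrite memvE.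
Qed.

Lemma fspanS S F : S \subset F -> (fspan S <= fspan F)%VS.
Proof. by move=> /subsetP h; apply/fspan_subP => x /h /mem_fspan. Qed.

Lemma fspanU S F : fspan (S :|: F) = (fspan S + fspan F)%VS.
Proof.
apply/eqP; rewrite eqEsubv subv_add !fspanS ?subsetUl ?subsetUr // !andbT.
apply/fspan_subP => x /setUP[] /mem_fspan; apply: subvP.
  exact: addvSl.
exact: addvSr.
Qed.

Lemma dim_fspan_le S : (\dim (fspan S) <= #|S|)%N.
Proof.
apply: leq_trans (dimv_leq_sum _ _ _) _.
by rewrite -sum1_card; apply: leq_sum => x _; rewrite dim_vline leq_b1.
Qed.

Lemma dim_addv_line (U : {vspace vT}) v :
  v \notin U -> \dim (U + <[v]>)%VS = (\dim U).+1.
Proof.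
move=> vU; rewrite dimv_disjoint_sum ?dim_vline; last first.
  apply/eqP; rewrite -subv0; apply/subvP => w /memv_capP[wU /vlineP[a wa]].
  rewrite memv0 wa; apply: contraNT vU => w0.
  have a0 : a != 0 by apply: contraNneq w0 => ->; rewrite scale0r.
  by rewrite -[v](scalerK a0) memvZ // -wa.
by rewrite (_ : v != 0) ?addn1 //; apply: contraNneq vU => ->; rewrite mem0v.
Qed.

(** Induction on the number of elements: [x] is kept only if it lies outside the span of the
    remaining ones. For graphs this replaces a set of edges by a forest with the same span. *)
Lemma fspan_basis S :
  exists2 F : {set T}, F \subset S &
    fspan F = fspan S /\ (#|F| <= \dim (fspan S))%N.
Proof.
move: {2}#|S| (leqnn #|S|) => n; elim: n S => [|n IHn] S.
  by rewrite leqn0 cards_eq0 => /eqP->; exists set0; rewrite ?sub0set ?cards0.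
have [->|[x xS] hn] := set_0Vmem S.
  by move=> _; exists set0; rewrite ?sub0set ?cards0.
have [|F FS [eFS cF]] := IHn (S :\ x).
  by rewrite (cardsD1 x S) xS in hn.
have FS' := subset_trans FS (subD1set S x).
have eS : fspan S = (fspan (S :\ x) + <[phi x]>)%VS.
  by rewrite -{1}(setD1K xS) setUC fspanU {2}/fspan big_set1.
have [xs|xs] := boolP (phi x \in fspan (S :\ x)).
  have -> : fspan S = fspan (S :\ x) by rewrite eS; apply/addv_idPl; rewrite -memvE.
  by exists F.
exists (x |: F); first by rewrite subUset sub1set xS.
rewrite setUC fspanU eFS {2}/fspan big_set1 -eS; split=> //.
rewrite eS dim_addv_line // (leq_trans (leq_card_setU F [set x])) //.
by rewrite cards1 addn1.
Qed.

(* Rado's theorem, by deleting elements one at a time: if neither of two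
   elements of [A i] could be deleted, submodularity of the dimension would
   violate the rank condition for the union or intersection of the two sets of
   indices witnessing it. *)
Lemma rado (I : finType) (A : I -> {set T}) :
  (forall J : {set I}, (#|J| <= \dim (fspan (\bigcup_(i in J) A i)))%N) ->
  exists g : I -> T, (forall i, g i \in A i) /\
    \dim (fspan [set g i | i : I]) = #|I|.
Proof.
have [n] := ubnP (\sum_i #|A i|)%N; elim: n A => // n IHn A hn rA.
have A0 i : (0 < #|A i|)%N.
  by apply: leq_trans (dim_fspan_le _); have := rA [set i]; rewrite cards1 big_set1.
(* If every [A i] is a singleton, the choice is forced and the rank condition for the set of all
   indices is the claim. *)
have [/existsP[i Ai]|/existsPn A1] := boolP [exists i, (1 < #|A i|)%N]; last first.
  have gP i : exists x, x \in A i by apply/set0Pn; rewrite -card_gt0.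
  exists (fun i => xchoose (gP i)); split=> [i|]; first exact: xchooseP.
  apply/eqP; rewrite eqn_leq; apply/andP; split.
    by rewrite (leq_trans (dim_fspan_le _)) // leq_imset_card.
  have := rA setT; rewrite cardsT => /leq_trans; apply.
  apply/dimvS/fspanS/subsetP => x /bigcupP[i _ xA].
  apply/imsetP; exists i => //; apply/eqP; apply: contraTT (A1 i) => nx.
  by rewrite negbK; apply/card_gt1P; exists x, (xchoose (gP i)); split=> //; exact: xchooseP.
have [x [y [xA yA xy]]] := card_gt1P Ai.
pose D z j := if j == i then A i :\ z else A j.
have DA z j : D z j \subset A j by rewrite /D; case: eqP => [->|_]; rewrite ?subD1set.
have lift z : z \in A i ->
   (forall J : {set I}, (#|J| <= \dim (fspan (\bigcup_(j in J) D z j)))%N) ->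
   exists g : I -> T, (forall i, g i \in A i) /\
    \dim (fspan [set g i | i : I]) = #|I|.
  move=> zA /(IHn (D z))[|g [gD dg]]; last first.
    by exists g; split=> // j; exact: (subsetP (DA z j)).
  rewrite ltnS in hn; rewrite (leq_trans _ hn) // (bigD1 i) //= [X in (_ <= X)%N](bigD1 i) //=.
  rewrite -addSn leq_add //; last by apply: leq_sum => j _; rewrite subset_leq_card.
  by rewrite /D eqxx (cardsD1 z (A i)) zA.
have [/forallP|/forallPn[J hJ]] :=
   boolP [forall J : {set I}, (#|J| <= \dim (fspan (\bigcup_(j in J) D x j)))%N].
  exact: lift.
have [/forallP|/forallPn[L hL]] :=
   boolP [forall J : {set I}, (#|J| <= \dim (fspan (\bigcup_(j in J) D y j)))%N].
  exact: lift.
exfalso.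
(* Deleting [z] changes only [A i], so a set of indices violating the new condition contains [i]. *)
have iJ z (J' : {set I}) :
    ~~ (#|J'| <= \dim (fspan (\bigcup_(j in J') D z j)))%N -> i \in J'.
  apply: contraNT => iJ'; rewrite (eq_bigr A) ?rA // => j jJ.
  by rewrite /D; case: eqP => // ji; rewrite -ji jJ in iJ'.
have [iJ1 iL1] := (iJ _ _ hJ, iJ _ _ hL).
rewrite -!ltnNge in hJ hL.
set U := fspan _ in hJ; set W := fspan _ in hL.
(* As [x != y], the copies of [A i] without [x] and without [y] together still cover [A i]. *)
have hU : (#|J :|: L| <= \dim (U + W)%VS)%N.
  apply: leq_trans (rA _) _; apply: dimvS.
  rewrite /U /W -fspanU; apply: fspanS; apply/subsetP => w.
  move=> /bigcupP[j jJL wA]; rewrite inE.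
  have [ji|ji] := eqVneq j i.
    have [wx|wx] := eqVneq w x; apply/orP; [right|left]; apply/bigcupP; exists i => //.
      by rewrite /D eqxx !inE -ji wA wx xy.
    by rewrite /D eqxx !inE -ji wA wx.
  apply/orP; move: jJL => /setUP[jJ|jL]; [left|right]; apply/bigcupP; exists j => //.
    by rewrite /D (negbTE ji).
  by rewrite /D (negbTE ji).
have hI : (#|(J :&: L) :\ i| <= \dim (U :&: W)%VS)%N.
  apply: leq_trans (rA _) _; apply: dimvS; rewrite subv_cap.
  apply/andP; split; apply: fspanS; apply/subsetP => w /bigcupP[j];
    rewrite !inE => /and3P[ji jJ jL] wA; apply/bigcupP; exists j => //;
    by rewrite /D (negbTE ji).
(* The two dimensions add up to at most [#|J| + #|L| - 2], but the bounds for sum and intersection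
   add up to [#|J| + #|L| - 1]. *)
have := dimv_sum_cap U W; have := cardsUI J L.
have := cardsD1 i (J :&: L); rewrite inE iJ1 iL1 /=.
move: hU hI hJ hL; lia.
Qed.
End FamilySpan.

(** * The graphic matroid over F_2 *)

Lemma card_bigcup_le (I T : finType) (D : pred I) (U : I -> {set T}) :
  (#|\bigcup_(i | D i) U i| <= \sum_(i | D i) #|U i|)%N.
Proof.
elim/big_rec2: _ => [|x m B _ h]; first by rewrite cards0.
by apply: leq_trans (leq_card_setU _ _) _; rewrite leq_add2l.
Qed.

Section EdgeSets.
Variable V : finType.
Implicit Types (S F E : {set {set V}}) (A e : {set V}) (P : {set {set V}}).

Definition eadj S : rel V := fun x y => [set x; y] \in S.

(** The incidence vectors over F_2, whose linear matroid is the graphic one. [GRing.regular] makes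
    the field a vector space over itself. *)
Definition chi e : {ffun V -> GRing.regular 'F_2} := [ffun x => (x \in e)%:R].

Lemma eadj_sym S : symmetric (eadj S).
Proof. by move=> x y; rewrite /eadj setUC. Qed.

Lemma connect_eadj_sym S : connect_sym (eadj S).
Proof. by apply: sym_connect_sym; exact: eadj_sym. Qed.

Lemma connect_equiv S : {in setT & &, equivalence_rel (connect (eadj S))}.
Proof.
move=> x y z _ _ _; split; first exact: connect0.
by move=> xy; rewrite (same_connect (connect_eadj_sym S) xy).
Qed.

Definition components S := equivalence_partition (connect (eadj S)) setT.

Lemma components_partition S : partition (components S) setT.
Proof. by apply: equivalence_partitionP; exact: connect_equiv. Qed.

Lemma pblock_components S x y :
  (y \in pblock (components S) x) = connect (eadj S) x y.
Proof. by rewrite (pblock_equivalence_partition (@connect_equiv S)). Qed.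

Lemma pblock_components_mem S x : pblock (components S) x \in components S.
Proof. by rewrite pblock_mem // (cover_partition (components_partition S)) inE. Qed.

Lemma chi_set2 x y : x != y -> chi [set x; y] = chi [set x] + chi [set y].
Proof.
move=> xy; apply/ffunP => z; rewrite !ffunE !inE -natrD.
have [->|zx] := eqVneq z x; first by rewrite (negbTE xy).
by rewrite add0n.
Qed.

Lemma chi_add_self e : chi e + chi e = 0.
Proof.
apply/ffunP => z; rewrite !ffunE -mulr2n.
by case: (z \in e); [exact/eqP|rewrite mul0rn].
Qed.

(** The vectors of the edges of a path telescope in characteristic 2. *)
Lemma chi_connect S x y :
  connect (eadj S) x y -> chi [set x] + chi [set y] \in fspan chi S.
Proof.
move=> /connectP[p pp ->]; elim: p x pp => [|z p IH] x /=.
  by rewrite chi_add_self mem0v.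
case/andP=> xz /IH zl.
rewrite -[chi [set x]](addrK (chi [set z])) -addrA.
have -> : - chi [set z] = chi [set z].
  by apply/eqP; rewrite eq_sym -subr_eq0 opprK chi_add_self.
rewrite memvD //; have [->|nxz] := eqVneq x z; first by rewrite chi_add_self mem0v.
by rewrite -chi_set2 // mem_fspan.
Qed.

(** Summing coordinates over [A] is a linear form that kills [chi e] when [#|A :&: e|] is even. It
    certifies that vectors lie outside a span. *)
Lemma fspan_chi_even S A v : (forall e, e \in S -> ~~ odd #|A :&: e|) ->
  v \in fspan chi S -> \sum_(x in A) v x = 0.
Proof.
move=> even /memv_sumP[w wS ->].
under eq_bigr do rewrite sum_ffunE.
rewrite exchange_big /= big1 // => e eS.
have /vlineP[a ->] := wS e eS.
under eq_bigr do rewrite !ffunE.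
rewrite -scaler_sumr -natr_sum.
have -> : (\sum_(x in A) (x \in e))%N = #|A :&: e|.
  rewrite -sum1_card big_mkcond [RHS]big_mkcond /=; apply: eq_bigr => x _.
  by rewrite inE; case: (x \in A); case: (x \in e).
rewrite -[X in X%:R](odd_double_half #|A :&: e|) (negbTE (even e eS)) add0n.
rewrite -muln2 natrM (_ : 2%:R = 0) ?mulr0 ?scaler0 //; exact/eqP.
Qed.

(** The component of [x] meets each edge of [S] in 0 or 2 vertices; if it missed [y], it would meet
    [[set x; y]] in one. *)
Lemma chi_fspan_connect S x y : (forall e, e \in S -> #|e| = 2) ->
  x != y -> chi [set x; y] \in fspan chi S -> connect (eadj S) x y.
Proof.
move=> S2 xy xyS; apply: contraT => nc.
have := @fspan_chi_even S [set z | connect (eadj S) x z] _ _ xyS.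
rewrite (bigD1 x) ?inE //= ffunE !inE eqxx big1 => [|z /andP[+ zx]]; last first.
  by rewrite inE !ffunE !inE (negbTE zx); case: eqVneq nc => // -> /negbTE->.
move=> h; suff /h /eqP : forall e, e \in S ->
    ~~ odd #|[set z | connect (eadj S) x z] :&: e| by [].
move=> e eS; have /eqP/cards2P[u [v [uv euv]]] := S2 e eS.
have cuv : connect (eadj S) x u = connect (eadj S) x v.
  rewrite ![connect _ x _](connect_eadj_sym S).
  by apply: same_connect; [exact: connect_eadj_sym|apply: connect1; rewrite /eadj -euv].
have [xu|xu] := boolP (connect (eadj S) x u).
  rewrite (setIidPr _) ?S2 //; rewrite euv subUset !sub1set !inE -cuv.
  by rewrite xu.
rewrite (_ : _ :&: _ = set0) ?cards0 //; apply/eqP; rewrite setI_eq0 euv.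
rewrite disjoint_sym disjoints_subset subUset !sub1set !inE -cuv.
by rewrite xu.
Qed.

Lemma dim_ffun_F2 : \dim {: {ffun V -> GRing.regular 'F_2}} = #|V|.
Proof. by rewrite dimvf /dim /= muln1. Qed.

(** If [x] and [y] were not connected, adding [[set x; y]] would raise the dimension to [#|V|]; but
    every vector spanned by edges has coordinate sum 0, unlike [chi [set x]]. *)
Lemma spanning_connected S : (forall e, e \in S -> #|e| = 2) ->
  (#|V| <= (\dim (fspan chi S)).+1)%N -> forall x y, connect (eadj S) x y.
Proof.
move=> S2 dS x y; apply: contraT => nc.
have xy : x != y by apply: contraNneq nc => ->.
have nxy : chi [set x; y] \notin fspan chi S.
  by apply: contra nc; exact: chi_fspan_connect.
have full : fspan chi (S :|: [set [set x; y]]) = fullv.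
  apply/eqP; rewrite eqEdim subvf dim_ffun_F2 fspanU {2}/fspan big_set1.
  by rewrite dim_addv_line.
have := @fspan_chi_even (S :|: [set [set x; y]]) setT (chi [set x]).
rewrite full memvf (bigD1 x) //= ffunE inE eqxx big1 => [|z /andP[_ zx]]; last first.
  by rewrite ffunE inE (negbTE zx).
move=> h; suff /h /(_ isT) /eqP : forall e, e \in S :|: [set [set x; y]] ->
    ~~ odd #|setT :&: e| by [].
by move=> e; rewrite setTI !inE => /orP[/S2->//|/eqP->]; rewrite cards2 xy.
Qed.

(** An edge of a cycle is in the span of the other edges, so deleting it would leave [#|S|]
    independent vectors among [#|S| - 1]. *)
Lemma independent_acyclic S c : (#|S| <= \dim (fspan chi S))%N ->
  ucycle (eadj S) c -> (size c < 3)%N.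
Proof.
move=> iS; case: c => [|x [|y [|z p]]] //= /andP[].
move=> /= /and3P[xy yz zp] /and4P[]; rewrite !inE !negb_or.
move=> /and3P[nxy nxz xp] /andP[nyz yp] zp' up.
set e := [set x; y] in xy.
(* Each edge of such a path starts at a vertex outside [e], so it survives the deletion of [e]. *)
have aux u q : path (eadj S) u (rcons q x) -> all (fun v => v \notin e) (u :: q) ->
    path (eadj (S :\ e)) u (rcons q x).
  elim: q u => [|v q IH] u /=.
    rewrite !andbT => ux ue; rewrite /eadj in_setD1 [_ \in S]ux andbT.
    by apply: contraNneq ue => <-; rewrite !inE eqxx.
  case/andP => uv vq /andP[ue ve]; rewrite IH // andbT /eadj in_setD1 [_ \in S]uv andbT.
  by apply: contraNneq ue => <-; rewrite !inE eqxx.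
have cyx : connect (eadj (S :\ e)) y x.
  apply: (@connect_trans _ _ z).
    apply: connect1; rewrite /eadj in_setD1 [_ \in S]yz andbT.
    apply: contra_neqN nxz => /eqP/setP/(_ z); rewrite !inE eqxx orbT.
    by rewrite eq_sym [z == y]eq_sym (negbTE nyz) orbF => /esym/eqP.
  have := aux z p zp; rewrite /= !inE negb_or eq_sym nxz eq_sym nyz /=.
  have -> : all (fun v => v \notin e) p.
    apply/allP => v vp; rewrite !inE negb_or.
    apply/andP; split; [apply: contraNneq xp|apply: contraNneq yp]; by move=> <-.
  by move=> /(_ isT) h; apply/connectP; exists (rcons p x); rewrite ?last_rcons.
have := chi_connect cyx; rewrite addrC -chi_set2 // => eW.
have : (fspan chi S <= fspan chi (S :\ e))%VS.
  apply/fspan_subP => f fS; have [->//|fe] := eqVneq f e.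
  by rewrite mem_fspan // in_setD1 fe.
move=> /dimvS dSe.
have := leq_trans iS (leq_trans dSe (dim_fspan_le _ _)).
by rewrite leqNgt proper_card // properD1.
Qed.

(** Modulo the span of [S], each [chi [set x]] equals the vector of the representative of its
    component, so adding one vector per component generates the whole space. *)
Lemma card_components S : (#|V| <= \dim (fspan chi S) + #|components S|)%N.
Proof.
rewrite -dim_ffun_F2.
pose rep (A : {set V}) := if [pick x in A] is Some x then chi [set x] else 0.
have h : (fullv <= fspan chi S + fspan rep (components S))%VS.
  apply/subvP => v _.
  have -> : v = \sum_x v x *: chi [set x].
    apply/ffunP => z; rewrite sum_ffunE (bigD1 z) //= big1 ?addr0 => [|y yz].
      by rewrite !ffunE inE eqxx; exact: esym (mulr1 _).
    by rewrite !ffunE inE eq_sym (negbTE yz) scaler0.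
  apply: memv_suml => x _; apply: memvZ.
  have xc : x \in cover (components S).
    by rewrite (cover_partition (components_partition S)) inE.
  have Bx := pblock_mem xc.
  have xB : x \in pblock (components S) x by rewrite mem_pblock.
  have := mem_fspan rep Bx; rewrite /rep; case: pickP => [y|/(_ x)]; last by rewrite xB.
  rewrite pblock_components => /chi_connect xy yr.
  rewrite -[chi [set x]](addrK (chi [set y])) memv_add // memvN //.
apply: leq_trans (dimvS h) _; apply: leq_trans (dimv_add_leqif _ _) _.
by rewrite leq_add2l dim_fspan_le.
Qed.

(** * Cuts and edges between the parts of a partition *)

Definition incident S x := [set y | eadj S x y].

Definition cut_size S A : nat := \sum_(x in A) #|incident S x :\: A|.

Definition crossing E P := [set e in E | [forall A in P, ~~ (e \subset A)]].

(** A vertex that is not isolated is covered by an edge, and an edge covers two vertices. *)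
Lemma card_isolated S :
  (forall e, e \in S -> #|e| = 2) ->
  (#|V| <= #|[set x | pblock (components S) x == [set x]]| + 2 * #|S|)%N.
Proof.
move=> S2; rewrite -(cardsC [set x | pblock (components S) x == [set x]]) leq_add2l.
apply: (@leq_trans #|cover S|).
  apply: subset_leq_card; apply/subsetP => x; rewrite !inE => nx.
  have /existsP[y /andP[/connectP[[|z p] /= xp ->]]] :
      [exists y, connect (eadj S) x y && (y != x)]; rewrite ?eqxx //.
    apply: contraR nx; rewrite negb_exists => /forallP h.
    apply/eqP/setP => y; rewrite pblock_components inE.
    have [->|yx] := eqVneq y x; first by rewrite connect0.
    by have := h y; rewrite yx andbT => /negbTE.
  by move: xp => /andP[xz _] _; apply/bigcupP; exists [set x; z]; rewrite ?set21.
apply: leq_trans (leq_card_cover S) _.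
rewrite (eq_bigr (fun=> 2%N)) => [|e /S2//].
rewrite sum_nat_const mulnC; exact: leqnn.
Qed.

(* Counts the darts [(x, y)] with [y \in Y x] by their underlying edges. *)
Lemma sum_darts_le S (X : {set V}) (Y : V -> {set V}) :
  {in X, forall x y, y \in Y x -> [set x; y] \in S} ->
  (\sum_(x in X) #|Y x| <= \sum_(e in S) #|e :&: X|)%N.
Proof.
move=> h; apply: (@leq_trans (\sum_(x in X) \sum_(e in S | x \in e) 1)%N).
  apply: leq_sum => x xX; rewrite sum1dep_card -(@card_in_imset _ _ (fun y => [set x; y])).
    apply: subset_leq_card; apply/subsetP => e /imsetP[y yY ->].
    by rewrite !inE eqxx h.
  move=> y z _ _ /setP eyz; have := eyz y; have := eyz z; rewrite !inE !eqxx !orbT.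
  have [->|_] := eqVneq z x; last by move=> /= /eqP ->.
  by move=> _ /esym /orP[] /eqP.
rewrite (exchange_big_dep (mem S)) /=; last by move=> x e _ /andP[].
apply: leq_sum => e eS; rewrite sum1dep_card.
by apply: subset_leq_card; apply/subsetP => x; rewrite !inE => /and3P[-> _ ->].
Qed.

Lemma sum_incident_le_crossing S P : (forall e, e \in S -> #|e| = 2) ->
  partition P setT ->
  (\sum_x #|incident S x :\: pblock P x| <= 2 * #|crossing S P|)%N.
Proof.
move=> S2 /and3P[/eqP cP tP _].
rewrite -(eq_bigl _ _ (@in_setT V)).
apply: (@leq_trans (\sum_(e in crossing S P) #|e :&: setT|)%N).
  apply: sum_darts_le.
  move=> x _ y; rewrite !inE => /andP[yP xy]; rewrite [_ \in S]xy /=.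
  apply/forall_inP => A AP; apply: contra yP; rewrite subUset !sub1set => /andP[xA yA].
  by rewrite (def_pblock tP AP xA).
rewrite (eq_bigr (fun=> 2%N)) => [|e]; last by rewrite setIT inE => /andP[/S2].
rewrite sum_nat_const mulnC; exact: leqnn.
Qed.

(** A crossing edge lies in the cuts of the two parts containing its ends. *)
Lemma sum_cut_le_crossing S P : (forall e, e \in S -> #|e| = 2) ->
  partition P setT -> (\sum_(A in P) cut_size S A <= 2 * #|crossing S P|)%N.
Proof.
move=> S2 pP; apply: leq_trans (sum_incident_le_crossing S2 pP).
have /and3P[/eqP cP tP _] := pP.
rewrite -(eq_bigl _ _ (@in_setT V)) -cP big_trivIset //=; apply: leq_sum => A AP; apply: leq_sum => x xA.
by rewrite (def_pblock tP AP xA).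
Qed.

Section RegularGraph.
Variables (G : sgraph V) (d lam : nat).
Hypotheses (regG : regular G d) (connG : edge_connected G lam).

Lemma edges_card e : e \in edges G -> #|e| = 2.
Proof. by move=> eG; apply/eqP/(forall_inP (edges_card2 G)). Qed.

Lemma card_incident x : #|incident (edges G) x| = d.
Proof. exact: regG. Qed.

Lemma card_edges_le : (#|edges G| <= #|V| * d)%N.
Proof.
apply: (@leq_trans #|\bigcup_(x : V) [set [set x; y] | y in incident (edges G) x]|).
  apply: subset_leq_card; apply/subsetP => e eG.
  have /eqP/cards2P[x [y [_ exy]]] := edges_card eG.
  apply/bigcupP; exists x => //; apply/imsetP; exists y => //.
  by rewrite inE /eadj -exy.
apply: leq_trans (card_bigcup_le _ _) _.
rewrite -sum_nat_const; apply: leq_sum => x _.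
by rewrite -(card_incident x) leq_imset_card.
Qed.

(** Once the set [F] of edges leaving [A] is deleted, no path leads from [A] to its complement; so
    [F] has at least [lam] edges. *)
Lemma cut_ge_edge_connectivity A : (0 < #|A| < #|V|)%N ->
  (lam <= cut_size (edges G) A)%N.
Proof.
rewrite card_gt0 => /andP[/set0Pn[x xA] AT].
have [y yA] : exists y, y \notin A.
  apply/existsP; rewrite -negb_forall; apply: contraL AT => /forallP h.
  by rewrite -leqNgt -cardsT subset_leq_card //; apply/subsetP => z _; exact: h.
pose F := [set e in edges G | (e :&: A != set0) && ~~ (e \subset A)].
have FA : (#|F| <= cut_size (edges G) A)%N.
  apply: (@leq_trans #|\bigcup_(x in A) [set [set x; y] | y in incident (edges G) x :\: A]|).
    apply: subset_leq_card; apply/subsetP => e; rewrite inE => /and3P[eG].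
    move=> /set0Pn[u]; rewrite inE => /andP[ue uA] /subsetPn[v ve vA].
    have uv : u != v by apply: contraNneq vA => <-.
    have euv : e = [set u; v].
      apply/esym/eqP; rewrite eqEcard subUset !sub1set ue ve /=.
      by rewrite edges_card // cards2 uv.
    apply/bigcupP; exists u => //; apply/imsetP; exists v => //.
    by rewrite !inE vA /eadj -euv.
  apply: leq_trans (card_bigcup_le _ _) _.
  by apply: leq_sum => z _; rewrite leq_imset_card.
rewrite leqNgt; apply/negP => cA.
have FE : F \subset edges G by apply/subsetP => e; rewrite inE => /andP[].
have /connectP[p] := connG FE (leq_ltn_trans FA cA) x y.
elim: p x xA => [|z p IH] x xA /= => [_ yx|]; first by rewrite yx xA in yA.
case/andP => xz; apply: IH; apply: contraLR xz => zA.
rewrite /adj /= in_setD negb_and negbK.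
have [xzG|_] := boolP (_ \in edges G); last by rewrite orbT.
rewrite orbF inE xzG /=; apply/andP; split.
  by apply/set0Pn; exists x; rewrite !inE eqxx.
by rewrite subUset !sub1set (negbTE zA) andbF.
Qed.

(** All [d] edges at a vertex isolated in [F] cross. This is the bound used for few colors, where
    most vertices are isolated. *)
Lemma crossing_ge_isolated F : F \subset edges G ->
  ((#|V| - 2 * #|F|) * d <= 2 * #|crossing (edges G) (components F)|)%N.
Proof.
move=> FE; apply: leq_trans (sum_incident_le_crossing edges_card (components_partition F)).
set X := [set x | pblock (components F) x == [set x]].
apply: (@leq_trans (#|X| * d)).
  rewrite leq_mul2r leq_subLR addnC card_isolated ?orbT // => e eF.
  by rewrite edges_card // (subsetP FE).
rewrite -sum_nat_const big_mkcond; apply: leq_sum => x _.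
case: ifP => //; rewrite inE => /eqP->.
rewrite -(card_incident x); apply: subset_leq_card; apply/subsetP => y.
rewrite !inE => xy; rewrite xy andbT; apply: contraTneq xy => ->.
apply/negP; rewrite /eadj setUid => /edges_card.
by rewrite cards1.
Qed.

Lemma components_proper F A : (1 < #|components F|)%N -> A \in components F ->
  (0 < #|A| < #|V|)%N.
Proof.
have /and3P[_ /trivIsetP tP n0] := components_partition F.
move=> c1 AP; apply/andP; split.
  by rewrite card_gt0; apply: contraNneq n0 => <-.
have [B] : exists B, B \in components F :\ A.
  by apply/set0Pn; rewrite -card_gt0 -ltnS; move: c1; rewrite (cardsD1 A) AP add1n.
rewrite !inE => /andP[BA BP]; have [z zB] : exists z, z \in B.
  by apply/set0Pn; apply: contraNneq n0 => <-.
rewrite -cardsT proper_card // properT; apply/eqP => AT.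
by have := disjointFr (tP _ _ BP AP BA) zB; rewrite AT inE.
Qed.

(** Parts are proper subsets so that edge-connectivity bounds their cuts; [P] is nonempty so that
    the term 1 of an expanded product can be discarded. *)
Definition proper_partition P :=
  [&& partition P setT, (0 < #|P|)%N & [forall A in P, 0 < #|A| < #|V|]%N].

Lemma proper_partition_components F :
  (1 < #|components F|)%N -> proper_partition (components F).
Proof.
move=> c1; rewrite /proper_partition components_partition ltnW //=.
by apply/forall_inP => A; exact: components_proper.
Qed.

(** There are at least [#|V| - #|F|] components, hence at least two, and each has a cut of size at
    least [lam]. *)
Lemma crossing_ge_connectivity F : (#|F|.+1 < #|V|)%N ->
  ((#|V| - #|F|) * lam <= 2 * #|crossing (edges G) (components F)|)%N.
Proof.
move=> F2.
have hc : (#|V| - #|F| <= #|components F|)%N.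
  by rewrite leq_subLR (leq_trans (card_components F)) // leq_add2r dim_fspan_le.
apply: leq_trans (sum_cut_le_crossing edges_card (components_partition F)).
apply: (@leq_trans (#|components F| * lam)); first by rewrite leq_mul2r hc orbT.
rewrite -sum_nat_const; apply: leq_sum => A AP.
apply: cut_ge_edge_connectivity; apply: components_proper AP.
by apply: leq_trans hc; rewrite ltn_subRL addn1.
Qed.

End RegularGraph.
End EdgeSets.

(** * Sets with small cuts *)

Section Cuts.
Local Open Scope nat_scope.

Variables (V : finType) (G : sgraph V) (d : nat).
Hypothesis regG : regular G d.
Implicit Types (A B R X Z : {set V}).

Local Notation N := (incident (edges G)).
Local Notation cutG := (cut_size (edges G)).

Definition symdiff A B := [set x | (x \in A) (+) (x \in B)].

(** The degree of [x] in the cut of [A], whichever side [x] is on. *)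
Definition xdeg A x := #|[set y in N x | (x \in A) (+) (y \in A)]|.

Lemma symdiffK R : involutive (symdiff R).
Proof. by move=> A; apply/setP => x; rewrite !inE; case: (x \in R); case: (x \in A). Qed.

Lemma symdiffC A B : symdiff A B = symdiff B A.
Proof. by apply/setP => x; rewrite !inE addbC. Qed.

Lemma mem_incidentC x y : (y \in N x) = (x \in N y).
Proof. by rewrite !inE eadj_sym. Qed.

Lemma xdegE A x : xdeg A x = \sum_(y in N x) ((x \in A) (+) (y \in A)).
Proof.
rewrite /xdeg -sum1_card big_mkcond [RHS]big_mkcond; apply: eq_bigr => y _ /=.
by rewrite inE; case: (y \in N x) => //=; case: (_ (+) _).
Qed.

Lemma cutE A : cutG A = \sum_(x in A) \sum_(y in N x | y \notin A) 1.
Proof.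
apply: eq_bigr => x _; rewrite sum1dep_card; apply: eq_card => y.
by rewrite !inE andbC.
Qed.

(* Counts the edges between [X] and its complement that [A] separates, each in
   both directions. *)
Lemma sum_xdeg_ge A X :
  2 * (\sum_(x in X) \sum_(y in N x | y \notin X) ((x \in A) (+) (y \in A))) <=
  \sum_x xdeg A x.
Proof.
pose m x y : nat := (y \in N x) && ((x \in A) (+) (y \in A)).
have mC x y : m x y = m y x by rewrite /m mem_incidentC addbC.
have -> : \sum_(x in X) \sum_(y in N x | y \notin X) ((x \in A) (+) (y \in A)) =
    \sum_(x in X) \sum_(y | y \notin X) m x y.
  apply: eq_bigr => x _; rewrite big_mkcondl /=; apply: eq_bigr => y _.
  by rewrite /m; case: (y \in N x).
rewrite mul2n -addnn {2}exchange_big /=.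
under [X in _ + X]eq_bigr do under eq_bigr do rewrite mC.
rewrite (bigID (mem X) predT) /= leq_add //; apply: leq_sum => x _; rewrite xdegE.
  rewrite big_mkcond [X in _ <= X]big_mkcond; apply: leq_sum => y _ /=.
  by rewrite /m; case: (y \in X); case: (y \in N x).
rewrite big_mkcond [X in _ <= X]big_mkcond; apply: leq_sum => y _ /=.
by rewrite /m; case: (y \in X); case: (y \in N x).
Qed.

Lemma sum_xdeg A : \sum_x xdeg A x = 2 * cutG A.
Proof.
pose m x y : nat := y \in N x.
have mC x y : m x y = m y x by rewrite /m mem_incidentC.
have cE : cutG A = \sum_(x in A) \sum_(y | y \notin A) m x y.
  rewrite cutE; apply: eq_bigr => x _; rewrite big_mkcondl /=; apply: eq_bigr => y _.
  by rewrite /m; case: (y \in N x).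
rewrite mul2n -addnn {1}cE cE [X in _ + X]exchange_big /=.
under [X in _ = _ + X]eq_bigr do under eq_bigr do rewrite mC.
rewrite (bigID (mem A) predT) /=; congr (_ + _); apply: eq_bigr => x xA; rewrite xdegE.
  rewrite xA big_mkcond [RHS]big_mkcond; apply: eq_bigr => y _ /=.
  by rewrite /m; case: (y \in A); case: (y \in N x).
rewrite (negbTE xA) big_mkcond [RHS]big_mkcond; apply: eq_bigr => y _ /=.
by rewrite /m; case: (y \in A); case: (y \in N x).
Qed.

Lemma cut_ge_card A : #|A| * (d - #|A|) <= cutG A.
Proof.
rewrite -sum_nat_const; apply: leq_sum => x _.
rewrite leq_subLR -(card_incident regG x) -(cardsID A (N x)) leq_add2r.
by rewrite subset_leq_card // subsetIr.
Qed.

(** Each edge leaving [X] belongs to the cut of some [A] in [RR]; the factor 2 comes from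
    [sum_xdeg], which counts cut edges from both ends. *)
Lemma cut_le_separated (RR : {set {set V}}) X :
  (forall x y, x \in X -> y \in N x -> y \notin X ->
    exists2 A, A \in RR & (x \in A) (+) (y \in A)) ->
  cutG X <= \sum_(A in RR) 2 * cutG A.
Proof.
move=> sep; under eq_bigr do rewrite -sum_xdeg.
rewrite exchange_big /= (bigID (mem X) predT) /= (leq_trans _ (leq_addr _ _)) //.
apply: leq_sum => x xX.
apply: leq_trans (card_bigcup_le (mem RR) _).
apply: subset_leq_card; apply/subsetP => y; rewrite in_setD => /andP[yX yN].
have [A AR xyA] := sep x y xX yN yX.
by apply/bigcupP; exists A => //; rewrite inE yN.
Qed.

Lemma cut_symdiff A B : cutG (symdiff A B) <= 2 * cutG A + 2 * cutG B.
Proof.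
apply: leq_trans (@cut_le_separated [set A; B] _ _) _.
  move=> x y; rewrite !inE => hx _ hy.
  have [xyA|xyA] := boolP ((x \in A) (+) (y \in A)); first by exists A; rewrite ?set21.
  exists B; rewrite ?set22 //; move: hx hy xyA.
  by case: (x \in A); case: (x \in B); case: (y \in A); case: (y \in B).
have [->|AB] := eqVneq A B; first by rewrite setUid big_set1 leq_addr.
by rewrite big_setU1 ?inE //= big_set1.
Qed.

Lemma small_of_cut_le X b : cutG X <= b -> 2 * #|X| <= d -> d * #|X| <= 2 * b.
Proof. by have := cut_ge_card X; nia. Qed.

(** * A bounded net for the sets with small cuts *)

Section Separated.
Variables (L b : nat).
Let t := (2 ^ L).+1.
Hypotheses (d_gt0 : 0 < d) (VL : 2 * #|V| <= L * d)
  (b_small : 2 * (2 ^ t * (4 * t * b)) <= d * d).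

(* If more than [2 ^ L] sets with small cuts were pairwise far apart, the atoms
   of the algebra generated by [t] of them would have small cuts, hence be
   negligible or have at least [d / 2] points; there are at most [L] of the
   latter, so two of the sets would agree up to negligible atoms. *)
Lemma card_separated_le (RR : {set {set V}}) :
  {in RR, forall A, cutG A <= b} ->
  {in RR &, forall A B, A != B -> 8 * b < d * #|symdiff A B|} ->
  #|RR| <= 2 ^ L.
Proof.
move=> cR sR; rewrite leqNgt; apply/negP => cardR.
have [S SR cS] : exists2 S : {set {set V}}, S \subset RR & #|S| = t.
  have [h|[S]] := set_0Vmem [set S : {set {set V}} | (S \subset RR) && (#|S| == t)].
    have := cards_draws RR t; rewrite h cards0 => /esym/eqP.
    by rewrite -[_ == _]negbK -lt0n bin_gt0 cardR.
  by rewrite inE => /andP[SR /eqP cS]; exists S.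
(* [sig v] records which of the [t] chosen sets contain [v]; the atoms are the fibres of [sig]. *)
pose sig v := [set A in S | v \in A].
pose atom s := [set v | sig v == s].
have catom s : cutG (atom s) <= 2 * t * b.
  apply: leq_trans (@cut_le_separated S _ _) _.
    move=> x y; rewrite !inE => /eqP <- _ /eqP nxy.
    have : exists A, (A \in sig x) (+) (A \in sig y).
      apply/existsP; apply: contra_notT nxy; rewrite negb_exists => /forallP h.
      by apply/setP => A; have := h A; case: (_ \in _); case: (_ \in _).
    by case=> A; rewrite !inE; case AS : (A \in S) => //=; exists A.
  apply: (@leq_trans (\sum_(A in S) 2 * b)); last by rewrite sum_nat_const cS mulnCA mulnA.
  apply: leq_sum => A AS.
  by rewrite leq_mul2l cR // (subsetP SR).
(* Atoms are disjoint, so at most [2 * #|V| / d], hence at most [L], of them are large. *)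
pose large := [set s | d <= 2 * #|atom s|].
have clarge : #|large| <= L.
  rewrite -(leq_pmul2r d_gt0); apply: leq_trans VL.
  rewrite -sum_nat_const; apply: leq_trans (_ : \sum_(s in large) 2 * #|atom s| <= _).
    by apply: leq_sum => s; rewrite inE.
  rewrite -big_distrr leq_mul2l /=.
  rewrite -[#|V|]cardsT -sum1_card (partition_big sig predT) //=.
  rewrite [X in _ <= X](bigID (mem large)) /= (leq_trans _ (leq_addr _ _)) //.
  apply: leq_sum => s _; rewrite -sum1_card leq_eqVlt; apply/orP; left; apply/eqP.
  by apply: eq_bigl => v; rewrite !inE.
pose pat (A : {set V}) := [set s in large | A \in s].
(* Pigeonhole: there are at most [2 ^ L] sets of large atoms, and [t] is one more. *)
have [A [B [AS BS AB pAB]]] : exists A B, [/\ A \in S, B \in S, A != B & pat A = pat B].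
  have /injectivePn : ~~ injectiveb (fun A : {A | A \in S} => pat (val A)).
    apply/negP => /injectiveP inj.
    have : #|[set pat (val A) | A : {A | A \in S}]| <= #|powerset large|.
      apply: subset_leq_card; apply/subsetP => _ /imsetP[A _ ->].
      by rewrite powersetE; apply/subsetP => s; rewrite inE => /andP[].
    rewrite card_imset // card_powerset card_sig.
    have -> : #|[pred x | x \in S]| = t by rewrite -cS; apply: eq_card.
    by rewrite /t ltnNge leq_exp2l ?clarge.
  by case=> A [B AB e]; exists (val A), (val B); split=> //; exact: valP.
(* Equal patterns put each large atom in both or neither of [A] and [B], so only small atoms make up
   the symmetric difference. *)
have sm : d * #|symdiff A B| <= 2 ^ t * (4 * t * b).
  have : symdiff A B \subset
      \bigcup_(s in powerset S | s \notin large) atom s.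
    apply/subsetP => v; rewrite inE => vAB; apply/bigcupP; exists (sig v); last by rewrite inE.
    apply/andP; split; first by rewrite powersetE; apply/subsetP => C; rewrite inE => /andP[].
    apply: contraTN vAB => vl; have := congr1 (fun s : {set {set {set V}}} => sig v \in s) pAB.
    by rewrite /= [X in X = _]inE [X in _ = X]inE vl /= !inE AS BS /= => ->; rewrite addbb.
  move=> /subset_leq_card/leq_trans/(_ (card_bigcup_le _ _)) h.
  apply: (leq_trans (leq_mul (leqnn d) h)).
  apply: (@leq_trans (\sum_(s in powerset S) 4 * t * b)).
    rewrite big_distrr /= [X in _ <= X](bigID (mem large)) /=.
    apply: leq_trans (leq_addl _ _); apply: leq_sum => s /andP[_].
    rewrite inE -ltnNge => sl.
    by have := small_of_cut_le (catom s) (ltnW sl); lia.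
  by rewrite sum_nat_const card_powerset cS.
have := sR _ _ (subsetP SR _ AS) (subsetP SR _ BS) AB.
have := cut_symdiff A B; have := cR _ (subsetP SR _ AS); have := cR _ (subsetP SR _ BS).
move=> cB cA cAB; rewrite ltnNge => /negP; apply.
(* By [sm] and [b_small] the symmetric difference has at most [d / 2] points; its cut then improves
   the bound to [8 * b], which contradicts separation. *)
have : cutG (symdiff A B) <= 4 * b by lia.
move=> /small_of_cut_le h; have := h; rewrite !mulnA; apply.
rewrite -(leq_pmul2r d_gt0); lia.
Qed.

(** A separated family of maximum size is a net: a set far from all its members could be added to
    it. *)
Lemma separated_net : exists RR : {set {set V}},
  [/\ #|RR| <= 2 ^ L, {in RR, forall A, cutG A <= b} &
    forall A, cutG A <= b -> exists2 R, R \in RR & d * #|symdiff R A| <= 8 * b].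
Proof.
pose good (RR : {set {set V}}) := [forall A in RR, cutG A <= b] &&
  [forall A in RR, forall B in RR, (A != B) ==> (8 * b < d * #|symdiff A B|)].
have good0 : good set0.
  by apply/andP; split; apply/forall_inP => A; rewrite inE.
case: (arg_maxnP (fun RR : {set {set V}} => #|RR|) good0) => RR gR mR.
have [/forall_inP cR /forall_inP sR] := andP gR.
exists RR; split=> //.
  apply: card_separated_le => // A B AR BR AB.
  by have /forall_inP/(_ B BR) := sR A AR; rewrite AB.
move=> A cA; have [AR|AR] := boolP (A \in RR).
  exists A => //; rewrite (_ : symdiff A A = set0) ?cards0 ?muln0 //.
  by apply/setP => x; rewrite !inE addbb.
apply/exists_inP; apply: contraT => /exists_inPn h.
have gA : good (A |: RR).
  apply/andP; split.
    by apply/forall_inP => B /setU1P[->//|/cR].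
  apply/forall_inP => B /setU1P[->|BR]; apply/forall_inP => C /setU1P[->|CR].
  - by rewrite eqxx.
  - by apply/implyP => _; rewrite symdiffC ltnNge h.
  - by apply/implyP => _; rewrite ltnNge h.
  - by have /forall_inP/(_ C CR) := sR B BR.
by have := mR _ gA; rewrite /= leqNgt cardsU1 AR add1n ltnSn.
Qed.
End Separated.

(** * Cuts of sets close to a given one *)

Section Perturbation.
Variables (h b : nat) (R : {set V}).
Hypotheses (cR : cutG R <= b) (b_small : 8 * b * h <= d * d) (d_gt0 : 0 < d).

(** Vertices with more than [d / h] of their edges in the cut of [R]: moving one across need not
    increase the cut. *)
Definition ambiguous := [set v | d < h * xdeg R v].

(** Markov's inequality for [xdeg R], whose sum is twice the cut. *)
Lemma card_ambiguous : #|ambiguous| * d <= 2 * h * b.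
Proof.
apply: (@leq_trans (h * \sum_x xdeg R x)); last first.
  by rewrite sum_xdeg mulnCA mulnA leq_mul2l cR orbT.
rewrite -sum_nat_const big_distrr /= [X in _ <= X](bigID (mem ambiguous)) /=.
by rewrite (leq_trans _ (leq_addr _ _)) //; apply: leq_sum => x; rewrite inE => /ltnW.
Qed.

(** A moved vertex that is not ambiguous has at most [d / h] edges in the cut of [R] and at most
    [d / h] neighbours that are also moved; its other edges all enter the cut of [A]. *)
Lemma cut_ge_perturbation A : d * #|symdiff R A| <= 8 * b ->
  #|symdiff R A :\: ambiguous| * ((h - 2) * d) <= h * cutG A.
Proof.
set X := symdiff R A => hX.
have hXd : h * #|X| <= d by rewrite -(leq_pmul2r d_gt0); nia.
have key : \sum_(x in X) \sum_(y in N x | y \notin X) ((x \in A) (+) (y \in A)) <= cutG A.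
  by have := sum_xdeg_ge A X; rewrite sum_xdeg leq_pmul2l.
apply: leq_trans (leq_mul (leqnn h) key).
rewrite -sum_nat_const big_distrr /= [X in _ <= X](bigID (mem ambiguous)) /=.
apply: leq_trans (leq_addl _ _).
rewrite [X in _ <= X](eq_bigl (mem (X :\: ambiguous))) => [|x]; last by rewrite !inE andbC.
apply: leq_sum => x; rewrite inE => /andP[xZ xX].
have : d <= \sum_(y in N x | y \notin X) ((x \in A) (+) (y \in A)) + xdeg R x + #|X|.
  rewrite -(card_incident regG x) xdegE -!sum1_card.
  rewrite (bigID (mem X) (mem (N x))) /= addnC leq_add //; last first.
    by rewrite big_mkcond [X in _ <= X]big_mkcond; apply: leq_sum => y _; case: (y \in X); rewrite ?andbF // andbT; case: ifP.
  rewrite [\sum_(y in N x) _](bigID (mem X)) /= [X in _ + X]addnC addnA (leq_trans _ (leq_addr _ _)) //.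
  rewrite -big_split /=; apply: leq_sum => y /andP[_].
  move: xX; rewrite !inE.
  by case: (x \in R); case: (x \in A); case: (y \in R); case: (y \in A).
move: xZ; rewrite inE -leqNgt.
move: (\sum_(y in N x | _) _) (xdeg R x) => s u; nia.
Qed.
End Perturbation.
End Cuts.

(** * The sum over all cuts *)

From mathcomp Require Import all_classical all_reals all_analysis.
From mathcomp Require Import ring lra.
Local Open Scope ring_scope.

Section RealSums.
Variable R : realType.

Lemma geometric_le (x : R) M : 0 <= x -> x <= 2^-1 ->
  \sum_(k < M) x ^+ k.+1 <= 2 * x.
Proof.
move=> x0 x1; elim: M => [|M IH]; first by rewrite big_ord0; lra.
rewrite big_ord_recl expr1.
have -> : \sum_(i < M) x ^+ (bump 0 i).+1 = x * \sum_(i < M) x ^+ i.+1.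
  by rewrite mulr_sumr; apply: eq_bigr => i _; rewrite -exprS.
nra.
Qed.

Lemma prod_1D_le_expR (I : finType) (P : pred I) (f : I -> R) :
  (forall i, P i -> 0 <= f i) ->
  \prod_(i | P i) (1 + f i) <= expR (\sum_(i | P i) f i).
Proof.
move=> f0; rewrite expR_sum; apply: ler_prod => i Pi.
by rewrite expR_ge1Dx andbT addr_ge0 // f0.
Qed.

Lemma sum_set_prod (I : finType) (f : I -> R) :
  \sum_(X : {set I}) \prod_(i in X) f i = \prod_i (1 + f i).
Proof.
under [RHS]eq_bigr do rewrite addrC.
rewrite bigA_distr; apply: eq_bigr => X _.
by rewrite big_mkcond.
Qed.
End RealSums.

Section LevelSum.
Variables (R : realType) (V : finType) (G : sgraph V) (d : nat).
Hypothesis regG : regular G d.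
Local Notation cutG := (cut_size (edges G)).

(** Each [A] is described by a point [Q] of the net and the set of moved vertices. The share
    [1 - kappa] of the exponent pays a factor [1 / #|V|] per moved vertex that is not ambiguous, and
    the share [kappa] leaves a factor decaying in [b]. Ambiguous vertices are few and cost a factor
    2 each. *)
Lemma sum_cut_level (L h b : nat) (a kappa : R) :
  (0 < #|V|)%N -> (0 < d)%N -> (0 < h)%N -> (2 * #|V| <= L * d)%N ->
  (2 * (2 ^ (2 ^ L).+1 * (4 * (2 ^ L).+1 * b)) <= d * d)%N ->
  (8 * b * h <= d * d)%N ->
  0 <= kappa <= 1 -> 0 <= a ->
  h%:R * ln (#|V|%:R : R) <= a * (1 - kappa) * ((h - 2) * d)%:R ->
  \sum_(A : {set V} | (cutG A <= b <= 2 * cutG A)%N) expR (- (a * (cutG A)%:R)) <=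
  (2 ^ L)%:R * (expR 1 * expR (ln 2 * ((2 * h * b)%:R / d%:R))
    * expR (- (a * kappa * (b%:R / 2)))).
Proof.
move=> n0 d0 h0 VL bs1 bs2 /andP[k0 k1] a0 hln.
have [RR [cRR cR nearR]] := separated_net regG d0 VL bs1.
have nR : 0 < (#|V|%:R : R) by rewrite ltr0n.
set n : R := #|V|%:R in nR hln *.
set E1 := expR (- (a * kappa * (b%:R / 2))).
pose near0 Q (A : {set V}) := (d * #|symdiff Q A| <= 8 * b)%N.
pose Z Q := ambiguous G d h Q.
have step1 A Q : (cutG A <= b <= 2 * cutG A)%N -> Q \in RR -> near0 Q A ->
    expR (- (a * (cutG A)%:R)) <= E1 * \prod_(v in symdiff Q A) (if v \in Z Q then 1 else n^-1).
  move=> /andP[cA bA] QR nQA.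
  have := cut_ge_perturbation regG (cR Q QR) bs2 d0 nQA.
  set X := symdiff Q A => hX.
  rewrite (bigID (mem (Z Q))) /= big1 ?mul1r; last by move=> v /andP[_ ->].
  rewrite (eq_bigr (fun=> n^-1)); last by move=> v /andP[_ /negbTE->].
  have -> : \prod_(i in X | i \notin Z Q) n^-1 = expR (- (#|X :\: Z Q|%:R * ln n)).
    rewrite -mulrN -lnV ?posrE // expRM_natl lnK ?posrE ?invr_gt0 //.
    rewrite -prodr_const; apply: eq_bigl => v.
    by rewrite finset.in_setD andbC.
  rewrite /E1 -expRD ler_expR -opprD lerN2.
  have c1 : a * kappa * (b%:R / 2) <= a * kappa * (cutG A)%:R.
    by rewrite ler_wpM2l ?mulr_ge0 // ler_pdivrMr // mulrC -natrM ler_nat.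
  have c2 : #|X :\: Z Q|%:R * ln n <= a * (1 - kappa) * (cutG A)%:R.
    have h0' : 0 < (h%:R : R) by rewrite ltr0n.
    rewrite -(ler_pM2l h0').
    apply: (@le_trans _ _ (#|X :\: Z Q|%:R * (a * (1 - kappa) * ((h - 2) * d)%:R))).
      by rewrite mulrCA ler_wpM2l.
    rewrite mulrCA [X in _ <= X]mulrCA ler_wpM2l ?mulr_ge0 ?subr_ge0 //.
    by rewrite -!natrM ler_nat.
  by rewrite -[X in _ <= X](_ : a * kappa * (cutG A)%:R + a * (1 - kappa) * (cutG A)%:R = _);
    [exact: lerD|ring].
have Zle Q : Q \in RR -> (2 : R) ^+ #|Z Q| <= expR (ln 2 * ((2 * h * b)%:R / d%:R)).
  move=> QR; rewrite -[X in X ^+ _](@lnK R 2) ?posrE // -expRM_natl mulrC ler_expR.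
  rewrite ler_wpM2l ?ln_ge0 ?ler1n // ler_pdivlMr ?ltr0n // -natrM ler_nat.
  exact: card_ambiguous _ (cR Q QR).
(* [symdiff Q] is an involution, so the sum over [A] runs over all sets of moved vertices and
   factorizes: [(1 + 1/n) ^ n] at most, times 2 per ambiguous vertex. *)
have sumX Q : Q \in RR -> \sum_A \prod_(v in symdiff Q A) (if v \in Z Q then 1 else n^-1) <=
    expR 1 * expR (ln 2 * ((2 * h * b)%:R / d%:R)).
  move=> QR; rewrite (reindex_inj (inv_inj (symdiffK Q))).
  under eq_bigr do rewrite symdiffK.
  rewrite sum_set_prod (bigID (mem (Z Q))) /= mulrC ler_pM ?prodr_ge0 //.
  - by move=> v _; case: ifP => _; rewrite addr_ge0 // invr_ge0 ltW.
  - by move=> v _; case: ifP => _; rewrite addr_ge0 // invr_ge0 ltW.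
  - rewrite (eq_bigr (fun=> 1 + n^-1)); last by move=> v /negbTE->.
    apply: le_trans (prod_1D_le_expR _) _; first by move=> _ _; rewrite invr_ge0 ltW.
    rewrite ler_expR -(mulVf (lt0r_neq0 nR)) sumr_const -mulr_natr.
    by apply: ler_wpM2l; rewrite ?ler_nat ?max_card // invr_ge0 ltW.
  - rewrite (eq_bigr (fun=> 2)) => [|v ->]; last by [].
    by rewrite prodr_const Zle.
apply: (@le_trans _ _ (\sum_(Q in RR) E1 *
    \sum_A \prod_(v in symdiff Q A) (if v \in Z Q then 1 else n^-1))).
  under [X in _ <= X]eq_bigr do rewrite mulr_sumr.
  rewrite exchange_big /= [X in _ <= X](bigID (fun A => cutG A <= b <= 2 * cutG A)%N) /=.
  rewrite -[X in X <= _]addr0 lerD //.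
    apply: ler_sum => A cA.
    have [Q QR nQA] := nearR A (proj1 (andP cA)).
    rewrite (bigD1 Q) //= -[X in X <= _]addr0 lerD ?step1 // sumr_ge0 // => Q' _.
    by rewrite mulr_ge0 ?expR_ge0 // prodr_ge0 // => v _; case: ifP; rewrite // invr_ge0 ltW.
  rewrite sumr_ge0 // => A _; rewrite sumr_ge0 // => Q' _.
  by rewrite mulr_ge0 ?expR_ge0 // prodr_ge0 // => v _; case: ifP; rewrite // invr_ge0 ltW.
apply: (@le_trans _ _ (\sum_(Q in RR) expR 1 * expR (ln 2 * ((2 * h * b)%:R / d%:R)) * E1)).
  by apply: ler_sum => Q QR; rewrite mulrC ler_wpM2r ?expR_ge0 // sumX.
rewrite sumr_const -[X in X <= _]mulr_natl; apply: ler_wpM2r; last by rewrite ler_nat.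
by rewrite !mulr_ge0 ?expR_ge0.
Qed.
End LevelSum.

Section CutSum.
Variable R : realType.

Lemma exists_nat_ge (x : R) : exists m : nat, x <= m%:R.
Proof.
by exists (Num.bound `|x|); rewrite (le_trans (ler_norm x)) // ltW // archi_boundP.
Qed.

Lemma expR_le_of_ln (x y : R) : 0 < y -> - ln y <= x -> expR (- x) <= y.
Proof. by move=> y0 h; rewrite -[y in _ <= y]lnK ?posrE // ler_expR lerNl. Qed.

(** Sets are grouped by the size of their cut in multiples of [lam]. Levels up to order [d ^ 2] form
    a geometric series by [sum_cut_level]; above them each term is so small that it beats the
    [2 ^ #|V|] sets. *)
Lemma sum_cut_le (c gam eps : R) : 0 < c -> 1 < gam -> 0 < eps ->
  exists K : R, forall (V : finType) (G : sgraph V) (d lam : nat),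
  regular G d -> edge_connected G lam -> (lam <= d)%N -> (d <= #|V|)%N ->
  (0 < #|V|)%N -> c * #|V|%:R <= lam%:R -> K <= ln #|V|%:R ->
  \sum_(A : {set V} | (0 < #|A| < #|V|)%N)
    expR (- (gam * ln #|V|%:R / d%:R * (cut_size (edges G) A)%:R)) <= eps.
Proof.
move=> c0 g1 e0.
have g0 : 0 < gam by lra.
(* With this choice [gam * (1 - kappa)] is [(gam + 1) / 2], still greater than 1. *)
pose kappa := (gam - 1) / (2 * gam).
have k0 : 0 < kappa by rewrite divr_gt0 //; lra.
have gk : gam * (1 - kappa) = (gam + 1) / 2.
  by rewrite /kappa; field; rewrite gt_eqF.
have k1 : kappa <= 1 by rewrite ler_pdivrMr; lra.
(* [h] is such that [(gam + 1) / 2 * (h - 2)] is at least [h], and [L] such that [2 * #|V|] is at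
   most [L * d]. *)
have [h hh] := exists_nat_ge (2 * (gam + 1) / (gam - 1)).
rewrite ler_pdivrMr in hh; last by lra.
have [L hL] := exists_nat_ge (2 / c).
rewrite ler_pdivrMr // in hL.
have K1E (u w v : nat) : ((2 * (u * (4 * w)) + 8 * h) * v =
    2 * (u * (4 * w * v)) + 8 * v * h)%N by lia.
pose t := (2 ^ L).+1%N.
(* [K1 * b <= d * d] implies both smallness conditions on [b] in [sum_cut_level]. *)
pose K1 := (2 * (2 ^ t * (4 * t)) + 8 * h)%N.
have h2 : 2 < (h%:R : R) by nra.
have h2' : (2 < h)%N by rewrite -(ltr_nat R).
have K1_gt0 : 0 < (K1%:R : R).
  by rewrite ltr0n /K1 addn_gt0 orbC muln_gt0 (ltn_trans _ h2').
pose tau := c * (gam * kappa) / 4.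
have tau0 : 0 < tau by apply: divr_gt0 => //; do 2 apply: mulr_gt0 => //.
pose C := (2 ^ L)%:R * expR 1 : R.
have C0 : 0 < C by rewrite mulr_gt0 ?expR_gt0 // ltr0n expn_gt0.
(* In order, [ln #|V|] is large enough to absorb the cost of ambiguous vertices, to make the ratio
   [x] at most 1/2, to make the geometric series at most [eps / 2], to make each tail term beat the
   number of sets, and to make [expR (- l)] at most [eps / 2]. *)
exists (Num.max (8 * h%:R * ln 2 / (gam * kappa))
  (Num.max (- ln 2^-1 / tau) (Num.max (- ln (eps / 4 / C) / tau)
  (Num.max ((ln 2 + 1) * (2 * K1%:R) / (gam * c)) (- ln (eps / 2)))))).
move=> V G d lam regG connG lamd dV n0 clam; rewrite !ge_max.
set n : R := #|V|%:R in clam *; set l := ln n.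
move=> /and5P[l1 l2 l3 l4 l5].
have nR : 1 <= n by rewrite ler1n.
have l0 : 0 <= l by rewrite ln_ge0.
have lam0 : 0 < (lam%:R : R) by apply: lt_le_trans clam; rewrite mulr_gt0 //; lra.
have lam0' : (0 < lam)%N by rewrite -(ltr0n R).
have d0' : (0 < d)%N := leq_trans lam0' lamd.
have d0 : 0 < (d%:R : R) by rewrite ltr0n.
have dn : (d%:R : R) <= n by rewrite ler_nat.
have lamdR : (lam%:R : R) <= d%:R by rewrite ler_nat.
have cd : c * d%:R <= lam%:R by nra.
have gk0 : 0 < gam * kappa by exact: mulr_gt0.
rewrite ler_pdivrMr // in l1; rewrite ler_pdivrMr // in l2.
rewrite ler_pdivrMr // in l3; rewrite ler_pdivrMr ?mulr_gt0 // in l4.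
set a := gam * l / d%:R.
have a0 : 0 <= a by rewrite divr_ge0 ?mulr_ge0 // ltW.
have ad : a * d%:R = gam * l by rewrite mulfVK // gt_eqF.
pose lev (A : {set V}) := (cut_size (edges G) A %/ lam)%N.
pose bb (k : nat) := (k.+1 * lam)%N.
(* The cut is at least [lam], so rounding it up to the next multiple of [lam] at most doubles it. *)
have bA (A : {set V}) : (0 < #|A| < #|V|)%N ->
    (cut_size (edges G) A <= bb (lev A) <= 2 * cut_size (edges G) A)%N.
  move=> AV; rewrite ltnW ?ltn_ceil //= /bb mulSn mul2n -addnn leq_add //.
    exact: cut_ge_edge_connectivity.
  exact: leq_divM.
rewrite (bigID (fun A => K1 * bb (lev A) <= d * d)%N) /=.
have -> : eps = eps / 2 + eps / 2 by lra.
pose x := expR (- (tau * l)).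
apply: lerD.
  have x2 : x <= 2^-1 by apply: expR_le_of_ln; rewrite ?invr_gt0 // mulrC.
  have xe : C * (2 * x) <= eps / 2.
    have : x <= eps / 4 / C.
      apply: expR_le_of_ln; last by rewrite [tau * l]mulrC.
      by rewrite divr_gt0 // divr_gt0.
    by rewrite ler_pdivlMr // mulrC; lra.
  (* [M] bounds all levels, so [inord] below never falls back on its default value. *)
  apply: le_trans xe; pose M := \max_(A : {set V}) lev A.
  have levM (A : {set V}) : (lev A < M.+1)%N by rewrite ltnS leq_bigmax.
  rewrite (partition_big (fun A => inord (lev A) : 'I_M.+1) predT) //=.
  apply: (@le_trans _ _ (\sum_(k < M.+1) C * x ^+ k.+1)); last first.
    by rewrite -mulr_sumr ler_wpM2l ?(ltW C0) // geometric_le // expR_ge0.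
  apply: ler_sum => k _.
  have [kd|kd] := boolP (K1 * bb k <= d * d)%N; last first.
    rewrite big1 ?mulr_ge0 ?(ltW C0) ?exprn_ge0 ?expR_ge0 // => A.
    by move=> /andP[/andP[_ +] /eqP/(congr1 val)]; rewrite /= inordK // => + lk; rewrite lk (negbTE kd).
  apply: (@le_trans _ _ (\sum_(A : {set V} | (cut_size (edges G) A <= bb k <= 2 * cut_size (edges G) A)%N)
     expR (- (a * (cut_size (edges G) A)%:R)))).
    rewrite [X in X <= _]big_mkcond [X in _ <= X]big_mkcond; apply: ler_sum => A _.
    case: ifP => [/andP[/andP[AV _] /eqP/(congr1 val)]|_].
      by rewrite /= inordK // => <-; rewrite bA.
    by case: ifP => // _; exact: expR_ge0.
  have dR : (2 * #|V| <= L * d)%N.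
    rewrite -(ler_nat R) !natrM -/n; apply: (@le_trans _ _ (L%:R * c * n)).
      by rewrite ler_wpM2r //; lra.
    by rewrite -mulrA ler_wpM2l // (le_trans clam).
  have h0 : (0 < h)%N by exact: ltn_trans h2'.
  rewrite /K1 K1E in kd.
  have b1 := leq_trans (leq_addr _ _) kd.
  have b2 := leq_trans (leq_addl _ _) kd.
  apply: le_trans (sum_cut_level regG n0 d0' h0 dR b1 b2 (kappa := kappa) _ a0 _) _.
  - by rewrite (ltW k0).
  - rewrite -/n -/l natrM natrB; last exact: ltnW.
    have -> : a * (1 - kappa) * ((h%:R - 2) * d%:R) =
      (a * d%:R) * ((1 - kappa) * (h%:R - 2)) by ring.
    have -> : a * d%:R * ((1 - kappa) * (h%:R - 2)) =
      gam * (1 - kappa) * (h%:R - 2) * l by rewrite ad; ring.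
    by rewrite gk ler_wpM2r //; clear -hh; lra.
  have -> : (2 ^ L)%:R * (expR 1 * expR (ln 2 * ((2 * h * bb k)%:R / d%:R)) *
      expR (- (a * kappa * ((bb k)%:R / 2)))) =
      C * (expR (ln 2 * ((2 * h * bb k)%:R / d%:R)) *
      expR (- (a * kappa * ((bb k)%:R / 2)))) by rewrite /C !mulrA.
  rewrite ler_wpM2l ?(ltW C0) // -expRD /x -expRM_natl ler_expR.
  set s : R := (bb k)%:R / d%:R.
  have sE : (bb k)%:R = s * d%:R by rewrite /s mulfVK // gt_eqF.
  have sk : k.+1%:R * c <= s.
    by rewrite /s ler_pdivlMr // /bb natrM -mulrA ler_wpM2l.
  have -> : ln 2 * ((2 * h * bb k)%:R / d%:R) = s * (2 * h%:R * ln 2).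
    by rewrite /s !natrM; ring.
  have -> : a * kappa * ((bb k)%:R / 2) = s * (l * (gam * kappa) / 2).
    by rewrite sE; transitivity (a * d%:R * (kappa * s / 2)); [ring|rewrite ad; ring].
  have -> : k.+1%:R * - (tau * l) = - (k.+1%:R * c * (l * (gam * kappa) / 4)).
    by rewrite /tau; ring.
  have lk0 : 0 <= l * (gam * kappa) by rewrite mulr_ge0 // ltW // mulr_gt0.
  have s0 : 0 <= s by rewrite /s divr_ge0.
  have : s * (2 * h%:R * ln 2) <= s * (l * (gam * kappa) / 4).
    by rewrite ler_wpM2l //; clear -l1; lra.
  have : k.+1%:R * c * (l * (gam * kappa) / 4) <= s * (l * (gam * kappa) / 4).
    by rewrite ler_wpM2r // divr_ge0.
  move: (l * (gam * kappa)) => u; clear; lra.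
have tail (A : {set V}) : (0 < #|A| < #|V|)%N -> ~~ (K1 * bb (lev A) <= d * d)%N ->
    expR (- (a * (cut_size (edges G) A)%:R)) <= expR (- ((ln 2 + 1) * n)).
  move=> AV; rewrite -ltnNge => bd; rewrite ler_expR lerN2.
  set y : R := (cut_size (edges G) A)%:R.
  have yd : d%:R * d%:R <= 2 * K1%:R * y.
    have /andP[_ h1] := bA A AV.
    rewrite /y -!natrM ler_nat; apply: leq_trans (ltnW bd) _.
    apply: leq_trans (leq_mul (leqnn K1) h1) _.
    by rewrite mulnA [(K1 * 2)%N]mulnC.
  have yn : c * n * d%:R <= 2 * K1%:R * y.
    by apply: le_trans yd; rewrite ler_wpM2r // (le_trans clam).
  have yn' : c * n * (a * d%:R) <= 2 * K1%:R * (a * y).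
    have := ler_wpM2l a0 yn; clear.
    by rewrite !(mulrCA a).
  have l4' := ler_wpM2r (le_trans ler01 nR) l4.
  have K20 : 0 < 2 * K1%:R :> R by rewrite mulr_gt0.
  rewrite -(ler_pM2l K20) (le_trans _ yn') // ad.
  by move: l4'; clear; lra.
apply: (@le_trans _ _ (\sum_(A : {set V}) expR (- ((ln 2 + 1) * n)))).
  rewrite [X in X <= _]big_mkcond; apply: ler_sum => A _.
  by case: ifP => [/andP[AV hA]|_]; [exact: tail|exact: expR_ge0].
rewrite sumr_const -(finset.cardsT {set V}) -finset.powersetT card_powerset.
rewrite finset.cardsT -[X in X <= _]mulr_natl natrX -[X in X ^+ _](@lnK R 2) ?posrE //.
rewrite -expRM_natl -expRD.
apply: (@le_trans _ _ (expR (- l))); last by apply: expR_le_of_ln; rewrite ?divr_gt0.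
rewrite ler_expR -/n.
have : l < n by rewrite ln_sublinear // (lt_le_trans ltr01).
by clear; lra.
Qed.
End CutSum.

(** * The probability space *)

Lemma big_option (R : realType) (I : finType) (F : option I -> R) :
  \sum_o F o = F None + \sum_i F (Some i).
Proof.
rewrite (bigD1 None) //=; congr (_ + _).
rewrite (reindex_omap Some id) => [|[i|]] //=.
by apply: eq_bigl => i; rewrite eqxx.
Qed.

Section EdgeLaw.
Variables (R : realType) (V : finType) (E : {set {set V}}) (p : R) (k : nat).
Hypotheses (p0 : 0 <= p) (p1 : p <= 1) (k0 : (0 < k)%N).

Local Notation W := {ffun {set V} -> option 'I_k}.

(* [None] means that the edge is absent from the random subgraph; vertex sets
   that are not edges of the graph are always absent. *)
Definition edge_law (e : {set V}) (o : option 'I_k) : R :=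
  if e \in E then if o is Some _ then p / k%:R else 1 - p else (o == None)%:R.

Definition law (w : W) := \prod_e edge_law e (w e).

Definition prob (Q : pred W) := \sum_(w | Q w) law w.

Lemma edge_law_ge0 e o : 0 <= edge_law e o.
Proof.
rewrite /edge_law; case: ifP => // _; case: o => [_|]; first by rewrite divr_ge0.
by rewrite subr_ge0.
Qed.

Lemma edge_law_sum1 e : \sum_o edge_law e o = 1.
Proof.
rewrite big_option /edge_law; case: ifP => _ /=; last by rewrite big1 ?addr0.
rewrite sumr_const card_ord -[X in _ + X]mulr_natr mulfVK ?subrK //.
by rewrite pnatr_eq0 -lt0n.
Qed.

Lemma law_ge0 w : 0 <= law w.
Proof. by apply: prodr_ge0 => e _; exact: edge_law_ge0. Qed.

Lemma prob_union (I : finType) (D : pred I) (Q : pred W) (S : I -> pred W) :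
  (forall w, Q w -> exists2 i, D i & S i w) ->
  prob Q <= \sum_(i | D i) prob (S i).
Proof.
move=> QS; rewrite /prob.
rewrite (exchange_big_dep predT) //= [X in _ <= X](bigID Q) /=.
rewrite -[X in X <= _]addr0 lerD //; last first.
  by apply: sumr_ge0 => w _; apply: sumr_ge0 => i _; exact: law_ge0.
apply: ler_sum => w /QS[i Di Si]; rewrite (bigD1 i) ?Di //= lerDl.
by apply: sumr_ge0 => j _; exact: law_ge0.
Qed.

(** The coordinates are independent, so an event that constrains each of them separately is bounded
    by a product. *)
Lemma prob_cylinder_le (S : {set V} -> pred (option 'I_k)) (f : {set V} -> R)
    (Q : pred W) :
  (forall w, Q w -> forall e, S e (w e)) ->
  (forall e, \sum_(o | S e o) edge_law e o <= f e) ->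
  prob Q <= \prod_e f e.
Proof.
move=> QS Sf; apply: (@le_trans _ _ (\prod_e \sum_(o | S e o) edge_law e o)).
  rewrite (bigA_distr_big_dep _ _) /= /prob.
  rewrite [X in X <= _]big_mkcond [X in _ <= X]big_mkcond; apply: ler_sum => w _.
  case: ifP => [/QS Sw|_]; last by case: ifP => // _; exact: law_ge0.
  by have -> : w \in family S by apply/familyP => e; exact: Sw.
apply: ler_prod => e _; rewrite Sf andbT.
by apply: sumr_ge0 => o _; exact: edge_law_ge0.
Qed.

Lemma edge_law_sum_le1 e S : \sum_(o | S o) edge_law e o <= 1.
Proof.
rewrite -(edge_law_sum1 e) [X in _ <= X](bigID S) /= lerDl.
by apply: sumr_ge0 => o _; exact: edge_law_ge0.
Qed.

Lemma edge_law_colors e (J : {set 'I_k}) : e \in E ->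
  \sum_(o | if o is Some i then i \in J else false) edge_law e o = p * #|J|%:R / k%:R.
Proof.
move=> eE; rewrite big_mkcond big_option /= add0r -big_mkcond /=.
rewrite /edge_law eE sumr_const -[LHS]mulr_natr mulrAC.
by congr (_ * _%:R / _); exact: eq_card.
Qed.

Lemma edge_law_not_colors e (J : {set 'I_k}) : e \in E ->
  \sum_(o | if o is Some i then i \notin J else true) edge_law e o =
  1 - p * #|J|%:R / k%:R.
Proof.
move=> eE; rewrite -(edge_law_colors J eE) -(edge_law_sum1 e).
rewrite [X in _ = X - _](bigID (fun o : option 'I_k => if o is Some i then i \in J else false)) /=.
rewrite addrC addrK; apply: eq_bigl => -[i|] //=.
Qed.

Lemma prob_forest_le (F C : {set {set V}}) (J : {set 'I_k}) (Q : pred W) :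
  F \subset E -> C \subset E -> [disjoint F & C] ->
  (forall w, Q w -> {in F, forall e, if w e is Some i then i \in J else false} /\
     {in C, forall e, if w e is Some i then i \notin J else true}) ->
  let q := p * #|J|%:R / k%:R in
  prob Q <= q ^+ #|F| * (1 - q) ^+ #|C|.
Proof.
move=> FE CE FC QF; set q := p * #|J|%:R / k%:R; rewrite /=.
pose S e (o : option 'I_k) := if e \in F then (if o is Some i then i \in J else false)
  else if e \in C then (if o is Some i then i \notin J else true) else true.
apply: le_trans (@prob_cylinder_le S (fun e => if e \in F then q else
   if e \in C then 1 - q else 1) _ _ _) _.
- move=> w /QF[wF wC] e; rewrite /S; case: ifP => [/wF//|_].
  by case: ifP => [/wC|].
- move=> e; rewrite /S; case: ifP => [eF|_].
    by rewrite edge_law_colors // (fintype.subsetP FE).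
  case: ifP => [eC|_]; last exact: edge_law_sum_le1.
  by rewrite edge_law_not_colors // (fintype.subsetP CE).
rewrite (bigID (mem F)) /= (eq_bigr (fun=> q)) => [|e ->] //.
rewrite prodr_const ler_wpM2l //; first by rewrite exprn_ge0 // divr_ge0 ?mulr_ge0.
rewrite le_eqVlt; apply/orP; left; apply/eqP.
rewrite -prodr_const [LHS]big_mkcond [RHS]big_mkcond; apply: eq_bigr => e _.
have [eF|_] /= := boolP (e \in F) => //.
by rewrite (disjointFr FC eF).
Qed.

Definition colors_of (eta : W) :=
  [set i | [exists e, eta e == Some i]].

Definition support_of (eta : W) :=
  [set e | eta e != None].

Lemma card_colors_of eta : (#|colors_of eta| <= #|support_of eta|)%N.
Proof.
have i0 : 'I_k by exact: Ordinal k0.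
apply: (@leq_trans #|[set odflt i0 (eta e) | e in support_of eta]|); last exact: leq_imset_card.
apply: subset_leq_card; apply/fintype.subsetP => i; rewrite inE => /existsP[e /eqP ei].
by apply/imsetP; exists e; rewrite ?inE ei.
Qed.

(** [eta] exhibits some edges of [C] with their colors; every other edge of [C] is absent or repeats
    an exhibited color. *)
Definition witnessed (C : {set {set V}}) (eta w : W) :=
  [forall e in C, if eta e is Some i then w e == Some i
     else if w e is Some i then i \in colors_of eta else true].

Lemma prob_witnessed_le (C : {set {set V}}) eta (u : R) : C \subset E ->
  1 - p * (1 - #|support_of eta|%:R / k%:R) <= u ->
  prob (witnessed C eta) <=
  \prod_(e in C) (if eta e is Some _ then p / k%:R else u).
Proof.
move=> CE hu.
pose S e (o : option 'I_k) := if e \in C then (if eta e is Some i then o == Some i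
     else if o is Some i then i \in colors_of eta else true) else true.
rewrite [X in _ <= X]big_mkcond; apply: (@prob_cylinder_le S).
  move=> w /forall_inP h e; rewrite /S; case: ifP => // /h.
  by [].
move=> e; rewrite /S; case: ifP => [eC|_]; last exact: edge_law_sum_le1.
have eE := fintype.subsetP CE _ eC.
case: (eta e) => [i|]; first by rewrite big_pred1_eq /edge_law eE.
apply: le_trans hu.
rewrite (eq_bigl (fun o : option 'I_k => if o is Some i then i \notin ~: colors_of eta else true));
  last by move=> [i|] //=; rewrite finset.in_setC negbK.
rewrite edge_law_not_colors // cardsCs finset.setCK card_ord natrB; last first.
  by rewrite -[X in (_ <= X)%N]card_ord max_card.
have kR : 0 < (k%:R : R) by rewrite ltr0n.
rewrite lerD2l lerN2 -mulrA ler_wpM2l // mulrBl divff ?gt_eqF // lerD2l lerN2.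
by rewrite ler_wpM2r ?invr_ge0 // ler_nat card_colors_of.
Qed.

(** Since [th <= 1], the weight [th^-1 ^+ s * th ^+ #|support_of eta|] is at least 1. Inserting it
    and dropping the size conditions makes the sum over [eta] a product over the edges of [C], with
    factor [u + th * p] each. *)
Lemma sum_prob_witnessed_le (C : {set {set V}}) (s kap : nat) (th : R) :
  C \subset E -> 0 < th -> th <= 1 -> (kap <= k)%N ->
  \sum_(eta | [&& support_of eta \subset C, (#|support_of eta| <= s)%N &
      (#|support_of eta| <= kap)%N]) prob (witnessed C eta) <=
  th^-1 ^+ s * expR (- (p * (1 - kap%:R / k%:R - th) * #|C|%:R)).
Proof.
move=> CE th0 th1 kapk.
have kR : 0 < (k%:R : R) by rewrite ltr0n.
pose u := 1 - p * (1 - kap%:R / k%:R).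
have u0 : 0 <= u.
  rewrite subr_ge0 mulr_ile1 ?subr_ge0 ?gerBl ?divr_ge0 //.
  by rewrite ler_pdivrMr // mul1r ler_nat.
pose g e (o : option 'I_k) : R := if e \in C then
   (if o is Some _ then th * (p / k%:R) else u) else (o == None)%:R.
have g0 e o : 0 <= g e o.
  rewrite /g; case: ifP => // _; case: o => // _.
  by rewrite mulr_ge0 ?divr_ge0 // ltW.
apply: (@le_trans _ _ (\sum_(eta : W) th^-1 ^+ s * \prod_e g e (eta e))).
  rewrite big_mkcond; apply: ler_sum => eta _.
  case: ifP => [/and3P[sC ss sk]|_]; last first.
    by rewrite mulr_ge0 ?exprn_ge0 ?invr_ge0 ?(ltW th0) ?prodr_ge0.
  apply: le_trans (@prob_witnessed_le C eta u CE _) _.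
    rewrite /u lerD2l lerN2 ler_wpM2l // lerD2l lerN2.
    by rewrite ler_wpM2r ?invr_ge0 // ler_nat.
  have -> : \prod_e g e (eta e) = th ^+ #|support_of eta| *
      \prod_(e in C) (if eta e is Some _ then p / k%:R else u).
    rewrite -prodr_const [X in _ = X * _]big_mkcond [X in _ = _ * X]big_mkcond -big_split /=.
    apply: eq_bigr => e _; rewrite /g inE.
    have [eC|eC] := boolP (e \in C).
      by case: (eta e) => [i|] /=; rewrite ?mul1r.
    have -> : eta e = None.
      by apply/eqP; apply: contraNT eC => ne; apply: (fintype.subsetP sC); rewrite inE.
    by rewrite /= mulr1.
  rewrite mulrA ler_peMl //.
    by apply: prodr_ge0 => e _; case: (eta e) => // _; rewrite divr_ge0.
  by rewrite exprVn mulrC ler_pdivlMr ?exprn_gt0 // mul1r ler_wiXn2l // ltW.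
rewrite -mulr_sumr ler_wpM2l ?exprn_ge0 ?invr_ge0 ?(ltW th0) //.
rewrite -(bigA_distr_bigA g) /=.
rewrite (bigID (mem C)) /= mulrC big1 ?mul1r => [|e /negbTE eC]; last first.
  by rewrite big_option /g eC /= big1 ?addr0.
rewrite (eq_bigr (fun=> u + th * p)) => [|e eC]; last first.
  rewrite big_option /g eC sumr_const card_ord -[X in _ + X = _]mulr_natr -!mulrA mulVf ?mulr1 //.
  by rewrite gt_eqF.
rewrite prodr_const.
have -> : - (p * (1 - kap%:R / k%:R - th) * #|C|%:R) = #|C|%:R * (u + th * p - 1).
  by rewrite /u; ring.
have ut0 : 0 <= u + th * p by apply: addr_ge0 => //; rewrite mulr_ge0 // ltW.
rewrite expRM_natl lerXn2r ?nnegrE ?expR_ge0 //.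
by rewrite -[X in X <= _](subrK 1) addrC expR_ge1Dx.
Qed.
End EdgeLaw.

(** * From rainbow trees to the product space and Rado's condition *)

Section Conversion.
Variables (R : realType) (V : finType) (G : sgraph V) (p : R) (k : nat).
Hypotheses (p0 : 0 <= p) (p1 : p <= 1) (k0 : (0 < k)%N) (cV : #|V| = k.+1).
Local Notation E := (edges G).
Local Notation W := {ffun {set V} -> option 'I_k}.

(** With [k = #|V| - 1] colors a rainbow spanning tree uses every color once, hence the indexing by
    colors. *)
Definition has_rainbow_basis (w : W) :=
  exists g : 'I_k -> {set V}, (forall i, g i \in E /\ w (g i) = Some i) /\
    \dim (fspan (@chi V) [set g i | i : 'I_k]) = k.

Definition lacks_rainbow_basis : pred W := fun w => ~~ `[< has_rainbow_basis w >].

Definition encode (H : sgraph V) (f : coloring H k) : W := [ffun e => omap f (insub e)].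

Lemma encode_val (H : sgraph V) (f : coloring H k) (e : {e | e \in edges H}) :
  encode f (val e) = Some (f e).
Proof. by rewrite ffunE valK. Qed.

Lemma encode_eq_None (H : sgraph V) (f : coloring H k) e :
  (encode f e == None) = (e \notin edges H).
Proof.
rewrite ffunE; case: insubP => [e' -> _|/negbTE->] //=.
Qed.

Lemma encode_inj (H : sgraph V) : injective (@encode H).
Proof.
move=> f g fg; apply/ffunP => e; apply: Some_inj.
by rewrite -!encode_val fg.
Qed.

Lemma rainbow_basis_spanning_tree (H : sgraph V) (f : coloring H k) :
  has_rainbow_basis (encode f) -> has_rainbow_spanning_tree f.
Proof.
move=> [g [gE dg]].
have gH i : g i \in edges H.
  by have := encode_eq_None f (g i); have [_ ->] := gE i; case: (_ \in _).
have c2 : [forall e in [set g i | i : 'I_k], #|e| == 2%N].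
  by apply/forall_inP => e /imsetP[i _ ->]; exact: (forall_inP (edges_card2 H)).
have c2' e : e \in [set g i | i : 'I_k] -> #|e| = 2%N.
  by move=> /(forall_inP c2)/eqP.
exists (SGraph c2); first split.
- by apply/fintype.subsetP => e /imsetP[i _ ->].
- by move=> x y; apply: (spanning_connected c2'); rewrite cV dg.
- move=> c; apply: independent_acyclic.
  by rewrite dg -[X in (_ <= X)%N]card_ord; exact: leq_imset_card.
move=> e e' /imsetP[i _ ei] /imsetP[j _ ej] fee.
have := encode_val f e; have := encode_val f e'; rewrite -fee ei ej.
have [_ ->] := gE i; have [_ ->] := gE j; move=> <- [ij].
by apply: val_inj; rewrite ei ej ij.
Qed.

Lemma law_encode (H : sgraph V) (f : coloring H k) :
  Gp_prob G p H * coloring_prob R f = if subgraph H G then law E p (encode f) else 0.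
Proof.
rewrite /Gp_prob; case: ifP => [HG|_]; last by rewrite mul0r.
rewrite /law (bigID (mem E) predT) /= [X in _ = _ * X]big1 ?mulr1 => [|e eE]; last first.
  rewrite /edge_law (negbTE eE) encode_eq_None.
  by rewrite (contra _ eE) // => /(fintype.subsetP HG).
rewrite [RHS](eq_bigr (fun e => (if e \in edges H then p else 1 - p) *
    (if e \in edges H then k%:R^-1 else 1))) => [|e eE]; last first.
  rewrite /edge_law eE; have := encode_eq_None f e; case: (encode f e) => [i|] /=.
    by move=> /esym/negbFE ->.
  by move=> /esym/negbTE ->; rewrite mulr1.
rewrite big_split /=; congr (_ * _).
rewrite /coloring_prob prodr_const card_sig -big_mkcondr /=.
rewrite (eq_bigl (mem (edges H))) => [|e]; first by rewrite prodr_const.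
by rewrite andb_idl // => /(fintype.subsetP HG).
Qed.

(** Failing colorings are carried by [encode], preserving probabilities, to points lacking a rainbow
    basis. *)
Lemma Pr_colored_Gp_bounds :
  1 - prob E p lacks_rainbow_basis <=
  Pr_colored_Gp G p (fun H (f : coloring H k) => has_rainbow_spanning_tree f) <= 1.
Proof.
have coloring_ge0 (H : sgraph V) (f : coloring H k) : 0 <= coloring_prob R f.
  by apply: prodr_ge0 => e _; rewrite invr_ge0.
have Gp0 (H : sgraph V) : 0 <= Gp_prob G p H.
  rewrite /Gp_prob; case: ifP => // _; apply: prodr_ge0 => e _.
  by case: ifP => _ //; rewrite subr_ge0.
pose Q (H : sgraph V) (f : coloring H k) := `[< has_rainbow_spanning_tree f >].
have tot (H : sgraph V) : \sum_(f : coloring H k | Q H f) coloring_prob R f =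
    1 - \sum_(f : coloring H k | ~~ Q H f) coloring_prob R f.
  by rewrite -(coloring_prob_sum1 R H k0) [in RHS](bigID (Q H)) /= addrK.
rewrite /Pr_colored_Gp; apply/andP; split; last first.
  rewrite -(Gp_prob_sum1 G p); apply: ler_sum => H _; rewrite -/(Q H) -[X in _ <= X]mulr1 ler_wpM2l //.
  by rewrite (tot H) gerBl sumr_ge0.
rewrite (eq_bigr (fun H => Gp_prob G p H - \sum_(f : coloring H k | ~~ Q H f)
   Gp_prob G p H * coloring_prob R f)) => [|H _]; last first.
  by rewrite (tot H) mulrBr mulr1 mulr_sumr.
rewrite sumrB Gp_prob_sum1 lerD2l lerN2.
pose supp (w : W) := [set e | w e != None].
(* A point [w] determines its graph through its support, so it is counted at most once. *)
apply: (@le_trans _ _ (\sum_(H : sgraph V) \sum_(w | lacks_rainbow_basis w && (supp w == edges H)) law E p w)).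
  apply: ler_sum => H _.
  apply: (@le_trans _ _ (\sum_(w in [set encode f | f in [pred f : coloring H k | ~~ Q H f]]) law E p w)).
    rewrite big_imset /=; last by move=> f g _ _; exact: encode_inj.
    apply: ler_sum => f _; rewrite law_encode; case: ifP => // _; exact: law_ge0.
  rewrite [X in X <= _]big_mkcond [X in _ <= X]big_mkcond; apply: ler_sum => w _.
  case: ifP => [/imsetP[f nQ ->]|_]; last by case: ifP => // _; exact: law_ge0.
  rewrite ifT //; apply/andP; split.
    apply/negP => /asboolP/rainbow_basis_spanning_tree h.
    by move: nQ; rewrite inE => /negP; apply; exact/asboolP.
  by apply/eqP/setP => e; rewrite inE encode_eq_None negbK.
rewrite (exchange_big_dep lacks_rainbow_basis) /=; last by move=> H w _ /andP[].
apply: ler_sum => w bw.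
have [/existsP[H /eqP wH]|/existsPn nH] := boolP [exists H : sgraph V, supp w == edges H].
  rewrite (bigD1 H) ?bw ?wH //= big1 ?addr0 // => H' /andP[/eqP e1 /eqP e2].
  by case: e2; apply: val_inj; rewrite /= e1.
by rewrite big1 ?law_ge0 // => H /andP[_]; rewrite (negbTE (nH H)).
Qed.

Definition colored_in (J : {set 'I_k}) (o : option 'I_k) :=
  if o is Some i then i \in J else false.

Definition forest_event (J : {set 'I_k}) (F : {set {set V}}) : pred W := fun w =>
  [forall e in F, colored_in J (w e)] &&
  [forall e in crossing E (components F), ~~ colored_in J (w e)].

Lemma not_crossing_fspan (F : {set {set V}}) e : F \subset E -> e \in E ->
  chi e \in fspan (@chi V) F -> e \notin crossing E (components F).
Proof.
move=> FE eE eF; rewrite inE eE /= negb_forall_in.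
have F2 f : f \in F -> #|f| = 2%N by move=> /(fintype.subsetP FE); exact: edges_card.
have /eqP/cards2P[x [y [xy exy]]] := edges_card eE.
have cxy : connect (eadj F) x y by apply: chi_fspan_connect => //; rewrite -exy.
apply/exists_inP; exists (finset.pblock (components F) x).
  exact: pblock_components_mem.
by rewrite negbK exy finset.subUset !finset.sub1set !pblock_components connect0.
Qed.

(** Contrapositive of [rado], for the sets of edges of each color. *)
Lemma deficient_color_set w : lacks_rainbow_basis w -> exists J : {set 'I_k},
  (\dim (fspan (@chi V) [set e in E | colored_in J (w e)]) < #|J|)%N.
Proof.
move=> bw; have [/existsP//|/existsPn h] := boolP [exists J : {set 'I_k},
  (\dim (fspan (@chi V) [set e in E | colored_in J (w e)]) < #|J|)%N].
case/negP: bw; apply/asboolP.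
have [|g [gA dg]] := @rado _ _ _ (@chi V) _ (fun i => [set e in E | w e == Some i]).
  move=> J; have := h J; rewrite -leqNgt => /leq_trans; apply.
  apply/dimvS/fspanS/fintype.subsetP => e; rewrite inE => /andP[eE].
  case we : (w e) => [i|] //= iJ; apply/bigcupP; exists i => //.
  by rewrite inE eE we eqxx.
exists g; split; last by rewrite dg card_ord.
by move=> i; have := gA i; rewrite inE => /andP[-> /eqP].
Qed.

(** A deficient set [J] is treated through a forest if it has at most [m0] colors, and otherwise
    through the partition into components. *)
Lemma prob_lacks_rainbow_basis_le (m0 : nat) :
  prob E p lacks_rainbow_basis <=
  \sum_(JF : {set 'I_k} * {set {set V}} | [&& (0 < #|JF.1| <= m0)%N, JF.2 \subset E &
      (#|JF.2| < #|JF.1|)%N]) prob E p (forest_event JF.1 JF.2) +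
  \sum_(P : {set {set V}} | proper_partition P)
    \sum_(eta : W | [&& support_of eta \subset crossing E P, (#|support_of eta| <= #|P|)%N &
      (#|support_of eta| <= k - m0)%N]) prob E p (witnessed (crossing E P) eta).
Proof.
pose Q1 : pred W := fun w => [exists JF : {set 'I_k} * {set {set V}},
  [&& (0 < #|JF.1| <= m0)%N, JF.2 \subset E & (#|JF.2| < #|JF.1|)%N] && forest_event JF.1 JF.2 w].
pose Q2 : pred W := fun w => [exists P : {set {set V}}, proper_partition P &&
  [exists eta : W, [&& support_of eta \subset crossing E P, (#|support_of eta| <= #|P|)%N &
      (#|support_of eta| <= k - m0)%N] && witnessed (crossing E P) eta w]].
apply: (@le_trans _ _ (prob E p Q1 + prob E p Q2)); last first.
  apply: lerD; first by apply: prob_union => // w /existsP[JF /andP[]]; exists JF.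
  apply: (@le_trans _ _ (\sum_(P : {set {set V}} | proper_partition P) prob E p (fun w =>
     [exists eta : W, [&& support_of eta \subset crossing E P, (#|support_of eta| <= #|P|)%N &
      (#|support_of eta| <= k - m0)%N] && witnessed (crossing E P) eta w]))).
    by apply: prob_union => // w /existsP[P /andP[]]; exists P.
  apply: ler_sum => P _.
  by apply: prob_union => // w /existsP[eta /andP[]]; exists eta.
apply: (@le_trans _ _ (\sum_(b : bool | predT b) prob E p (if b then Q1 else Q2))); last first.
  by rewrite big_bool.
apply: prob_union => // w /deficient_color_set[J dJ].
set S := [set e in E | _] in dJ.
have SE : S \subset E by apply/fintype.subsetP => e; rewrite inE => /andP[].
have [Jm|Jm] := leqP #|J| m0.
  exists true => //; apply/existsP.
  have [F FS [eF cF]] := fspan_basis (@chi V) S.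
  have FE := fintype.subset_trans FS SE.
  exists (J, F); rewrite /= Jm FE (leq_ltn_trans cF dJ) (leq_ltn_trans _ dJ) //=.
  apply/andP; split; apply/forall_inP => e.
    by move=> /(fintype.subsetP FS); rewrite inE => /andP[].
  move=> eC; apply: contraL eC => eJ.
  have [eE|eE] := boolP (e \in E); last by rewrite inE (negbTE eE).
  by apply: not_crossing_fspan => //; rewrite eF mem_fspan // inE eE.
exists false => //; apply/existsP; exists (components S).
have cJ : (#|J| <= k)%N by rewrite -[X in (_ <= X)%N]card_ord max_card.
(* The rank is less than [#|J|], so there are more than [k.+1 - #|J|] components: more than the
   colors outside [J]. *)
have cP : (k.+1 < #|J| + #|components S|)%N.
  by have := card_components S; move: dJ; rewrite cV; lia.
have P1 : (1 < #|components S|)%N by lia.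
rewrite proper_partition_components //=; apply/existsP.
set C := crossing E (components S).
have wC e i : e \in C -> w e = Some i -> i \notin J.
  move=> eC wei; apply: contraL eC => iJ; have [eE|eE] := boolP (e \in E); last first.
    by rewrite inE (negbTE eE).
  by apply: not_crossing_fspan => //; rewrite mem_fspan // inE eE wei.
(* One crossing edge is picked for each color that occurs on [C]; [eta] exhibits exactly these. *)
pose pk (i : 'I_k) := [pick e in C | w e == Some i].
pose eta : W := [ffun e => if w e is Some i then if pk i == Some e then Some i else None else None].
have etaP e i : eta e = Some i -> [/\ e \in C, w e = Some i & pk i = Some e].
  rewrite ffunE; case we : (w e) => [j|] //; case: eqP => // pj [<-]; split=> //.
  by move: pj; rewrite /pk; case: pickP => // x /andP[xC _] [<-].
(* Crossing edges avoid the colors of [J], and distinct exhibited edges have distinct colors. *)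
have cs : (#|support_of eta| <= k - #|J|)%N.
  have -> : (k - #|J|)%N = #|~: J| by rewrite [RHS]cardsCs finset.setCK card_ord.
  apply: (@leq_trans #|[set odflt finset.set0 (pk i) | i in ~: J]|); last exact: leq_imset_card.
  apply: subset_leq_card; apply/fintype.subsetP => e; rewrite inE.
  case ee : (eta e) => [i|] // _; have [eC wei pe] := etaP _ _ ee.
  by apply/imsetP; exists i; rewrite ?pe // finset.in_setC (wC e).
exists eta; apply/andP; split.
  rewrite (leq_trans cs (leq_sub2l _ (ltnW Jm))) andbT; apply/andP; split; last first.
    by apply: leq_trans cs _; rewrite leq_subLR; exact: ltnW (ltnW cP).
  apply/fintype.subsetP => e; rewrite inE; case ee : (eta e) => [i|] // _.
  by have [] := etaP _ _ ee.
apply/forall_inP => e eC; case ee : (eta e) => [i|]; first by have [_ ->] := etaP _ _ ee.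
case we : (w e) => [i|] //; rewrite inE; apply/existsP.
case pe : (pk i) => [e'|]; last first.
  by move: pe; rewrite /pk; case: pickP => // /(_ e); rewrite eC we eqxx.
exists e'; move: (pe); rewrite /pk; case: pickP => // x /andP[_ /eqP wx] [xe'].
by rewrite ffunE -xe' wx pe xe' eqxx.
Qed.
End Conversion.

(** * The two regimes *)

Section Regimes.
Variables (R : realType) (V : finType) (G : sgraph V) (p : R) (k d : nat).
Hypotheses (p0 : 0 <= p) (p1 : p <= 1) (k0 : (0 < k)%N).
Hypothesis regG : regular G d.
Local Notation E := (edges G).
Local Notation W := {ffun {set V} -> option 'I_k}.

Lemma expR_sub1_le (y : R) : y <= 2^-1 -> 0 <= y -> expR y - 1 <= 2 * y.
Proof.
move=> y1 y0; have := expR_ge1Dx (- y); rewrite expRN => h.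
have : expR y * (1 - y) <= 1.
  by rewrite -[X in _ <= X](@mulfV _ (expR y)) ?gt_eqF ?expR_gt0 // ler_pM2l ?expR_gt0.
move=> h1; have : 0 < expR y := expR_gt0 y.
nra.
Qed.

(** The sum is enlarged to all nonempty sets, that is, to the expanded product of [1 + f x] without
    its term 1. *)
Lemma sum_nonempty_prod_le (T : finType) (f : T -> R) (P : pred {set T}) :
  (forall x, 0 <= f x) -> (forall X, P X -> (0 < #|X|)%N) ->
  \sum_(X | P X) \prod_(x in X) f x <= expR (\sum_x f x) - 1.
Proof.
move=> f0 P0; rewrite lerBrDl.
apply: le_trans (prod_1D_le_expR (P := predT) (fun x _ => f0 x)).
rewrite -sum_set_prod [X in _ <= X](bigD1 finset.set0) //= big_set0 lerD2l.
rewrite [X in X <= _]big_mkcond [X in _ <= X]big_mkcond; apply: ler_sum => X _.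
case: ifP => [/P0|_]; first by rewrite card_gt0 => ->.
by case: ifP => // _; exact: prodr_ge0.
Qed.

(** Twice the number of crossing edges dominates the sum of the cuts of the parts, so the bound for
    [P] factorizes over its parts; then partitions are relaxed to arbitrary nonempty families of
    proper subsets. *)
Lemma partition_regime_le (kap : nat) (th gam' : R) :
  0 < th -> th <= 1 -> (kap <= k)%N -> 0 <= gam' ->
  gam' <= p * (1 - kap%:R / k%:R - th) / 2 ->
  \sum_(P : {set {set V}} | proper_partition P)
    \sum_(eta : W | [&& support_of eta \subset crossing E P, (#|support_of eta| <= #|P|)%N &
      (#|support_of eta| <= kap)%N]) prob E p (witnessed (crossing E P) eta) <=
  expR (th^-1 * \sum_(A : {set V} | (0 < #|A| < #|V|)%N)
      expR (- (gam' * (cut_size E A)%:R))) - 1.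
Proof.
move=> th0 th1 kapk g0 gp.
pose f (A : {set V}) : R := if (0 < #|A| < #|V|)%N then th^-1 * expR (- (gam' * (cut_size E A)%:R)) else 0.
have -> : th^-1 * \sum_(A : {set V} | (0 < #|A| < #|V|)%N) expR (- (gam' * (cut_size E A)%:R)) =
    \sum_A f A by rewrite mulr_sumr big_mkcond.
have f0 A : 0 <= f A.
  by rewrite /f; case: ifP => // _; rewrite mulr_ge0 ?expR_ge0 // invr_ge0 ltW.
apply: le_trans (@sum_nonempty_prod_le _ f (@proper_partition V) f0 _); last by move=> P /and3P[].
apply: ler_sum => P pP; have /and3P[partP _ /forall_inP properP] := pP.
have CE : crossing E P \subset E by apply/fintype.subsetP => e; rewrite inE => /andP[].
apply: le_trans (sum_prob_witnessed_le p0 p1 k0 #|P| CE th0 th1 kapk) _.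
have -> : \prod_(A in P) f A = th^-1 ^+ #|P| * expR (\sum_(A in P) - (gam' * (cut_size E A)%:R)).
  rewrite expR_sum -prodr_const -big_split /=; apply: eq_bigr => A AP.
  by rewrite /f properP.
rewrite ler_wpM2l ?exprn_ge0 ?invr_ge0 ?(ltW th0) // ler_expR sumrN -mulr_sumr lerN2.
have := sum_cut_le_crossing (@edges_card V G) partP; rewrite -(ler_nat R) natr_sum natrM => h.
apply: le_trans (ler_wpM2l g0 h) _.
by rewrite mulrA ler_wpM2r // mulrC -ler_pdivlMl // mulrC.
Qed.

(** Here too a weight [th^-1 ^+ #|J| * th ^+ #|F|], at least 1, is inserted. The presence of the
    edges of [F] has probability [q ^+ #|F|], so the sum over all [F] is at most a product of
    factors [1 + th * q], one per edge of the graph. *)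
Lemma forest_sum_le (J : {set 'I_k}) (th e : R) : 0 < th -> th <= 1 ->
  (forall F : {set {set V}}, F \subset E -> (#|F| < #|J|)%N ->
     e <= #|crossing E (components F)|%:R) ->
  let q := p * #|J|%:R / k%:R in
  \sum_(F : {set {set V}} | (F \subset E) && (#|F| < #|J|)%N)
     prob E p (forest_event G J F) <=
  th^-1 ^+ #|J| * expR (th * q * (#|V| * d)%:R - q * e).
Proof.
move=> th0 th1 he; set q := p * #|J|%:R / k%:R; rewrite /=.
have kR : 0 < (k%:R : R) by rewrite ltr0n.
have q0 : 0 <= q by rewrite divr_ge0 ?mulr_ge0.
have q1 : q <= 1.
  rewrite ler_pdivrMr // mul1r -[X in _ <= X]mul1r ler_pM // ler_nat.
  by rewrite -[X in (_ <= X)%N]card_ord max_card.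
pose f (x : {set V}) : R := if x \in E then th * q else 0.
have f0 x : 0 <= f x by rewrite /f; case: ifP => // _; rewrite mulr_ge0 // ltW.
apply: (@le_trans _ _ (\sum_(F : {set {set V}}) th^-1 ^+ #|J| * expR (- (q * e)) * \prod_(x in F) f x)).
  rewrite big_mkcond; apply: ler_sum => F _.
  case: ifP => [/andP[FE FJ]|_]; last first.
    by rewrite mulr_ge0 ?prodr_ge0 // mulr_ge0 ?expR_ge0 // exprn_ge0 // invr_ge0 ltW.
  apply: le_trans (@prob_forest_le R V E p k p0 p1 k0 F (crossing E (components F)) J _ FE _ _ _) _.
  - by apply/fintype.subsetP => x; rewrite inE => /andP[].
  - rewrite finset.disjoints_subset; apply/fintype.subsetP => x xF; rewrite finset.in_setC.
    by apply: not_crossing_fspan; rewrite ?mem_fspan // (fintype.subsetP FE).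
  - move=> w /andP[/forall_inP h1 /forall_inP h2]; split=> x.
      by move=> /h1; rewrite /colored_in.
    by move=> /h2; rewrite /colored_in; case: (w x).
  rewrite -/q.
  have -> : \prod_(x in F) f x = th ^+ #|F| * q ^+ #|F|.
    rewrite -exprMn -prodr_const; apply: eq_bigr => x xF.
    by rewrite /f (fintype.subsetP FE).
  have e1 : (1 - q) ^+ #|crossing E (components F)| <= expR (- (q * e)).
    apply: (@le_trans _ _ (expR (- q) ^+ #|crossing E (components F)|)).
      by rewrite lerXn2r ?nnegrE ?subr_ge0 ?expR_ge0 // expR_ge1Dx.
    by rewrite -expRM_natl ler_expR mulrN lerN2 [X in _ <= X]mulrC ler_wpM2l // he.
  have t1 : 1 <= th^-1 ^+ #|J| * th ^+ #|F|.
    by rewrite exprVn mulrC ler_pdivlMr ?exprn_gt0 // mul1r ler_wiXn2l ?(ltW th0) // ltnW.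
  have -> : th^-1 ^+ #|J| * expR (- (q * e)) * (th ^+ #|F| * q ^+ #|F|) =
    (th^-1 ^+ #|J| * th ^+ #|F|) * (q ^+ #|F| * expR (- (q * e))).
    by rewrite mulrACA [expR _ * _]mulrC.
  rewrite -[X in X <= _]mul1r ler_pM ?mulr_ge0 ?exprn_ge0 ?subr_ge0 //.
  by rewrite ler_wpM2l // exprn_ge0.
rewrite -mulr_sumr sum_set_prod -mulrA ler_wpM2l ?exprn_ge0 ?invr_ge0 ?(ltW th0) //.
rewrite addrC expRD ler_wpM2l ?expR_ge0 //.
apply: le_trans (prod_1D_le_expR (P := predT) (fun x _ => f0 x)) _.
rewrite ler_expR -big_mkcond sumr_const -[X in X <= _]mulr_natr.
by rewrite ler_wpM2l ?mulr_ge0 ?(ltW th0) // ler_nat card_edges_le.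
Qed.
End Regimes.

(** * Asymptotics of the forest regime *)

Section Asymptotics.
Variable R : realType.

Lemma eventually_expR_le (a v : R) : 0 < a -> 0 < v ->
  exists K : R, forall l, K <= l -> expR (- (a * l)) <= v.
Proof.
move=> a0 v0; exists (- ln v / a) => l; rewrite ler_pdivrMr // mulrC => h.
exact: expR_le_of_ln.
Qed.

(** For [m] up to [#|V| / D], regularity makes each [J] contribute a power of [y / n] with [y]
    small. For larger [m], edge-connectivity gives a bound that beats the number of all [J]. *)
Lemma forest_regime_le (c eps e0 : R) (D : nat) :
  0 < c -> 0 < eps -> 0 < e0 -> 8 + 4 * eps <= eps * D%:R ->
  exists K : R, forall (V : finType) (G : sgraph V) (k d lam : nat) (p : R),
  #|V| = k.+1 -> (0 < k)%N -> regular G d -> edge_connected G lam ->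
  (lam <= d)%N -> (d <= #|V|)%N -> c * #|V|%:R <= lam%:R -> K <= ln #|V|%:R ->
  0 <= p -> p <= 1 -> p * d%:R = (2 + eps) * ln #|V|%:R ->
  \sum_(JF : {set 'I_k} * {set {set V}} |
      [&& (0 < #|JF.1| <= k - k %/ D)%N, JF.2 \subset edges G &
      (#|JF.2| < #|JF.1|)%N]) prob (edges G) p (forest_event G JF.1 JF.2) <= e0.
Proof.
move=> c0 eps0 e00 hD.
have D0 : 0 < (D%:R : R) by nra.
have ln2 : 0 <= ln 2 :> R by rewrite ln_ge0 // ler1n.
have D0' : (0 < D)%N by rewrite -(ltr0n R).
(* [th] is so small that the cost of choosing [F] uses only a fraction of the exponent gained from
   the crossing edges, in both cases. *)
have [th [th0 th1 the thc]] : exists th : R,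
    [/\ 0 < th, th <= 1, 2 * th * (2 + eps) <= eps / 8 & 2 * th * (2 + eps) <= c / (2 * D%:R)].
  have e2 : 0 < 2 * (2 + eps) by lra.
  exists (Num.min 1 (Num.min (eps / 8 / (2 * (2 + eps))) (c / (2 * D%:R) / (2 * (2 + eps))))).
  have c2 : 0 < c / (2 * D%:R) by rewrite divr_gt0 // mulr_gt0.
  have eps8 : 0 < eps / 8 by rewrite divr_gt0.
  split.
  - by rewrite !lt_min ltr01 /=; apply/andP; split; exact: divr_gt0.
  - by rewrite ge_min lexx.
  - by rewrite mulrAC [X in X <= _]mulrC -ler_pdivlMr // !ge_min lexx !orbT.
  - by rewrite mulrAC [X in X <= _]mulrC -ler_pdivlMr // !ge_min lexx !orbT.
have [K1 hK1] := @eventually_expR_le (eps / 8) (th * Num.min 2^-1 (e0 / 4))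
  ltac:(by rewrite divr_gt0) ltac:(by rewrite mulr_gt0 // lt_min invr_gt0 divr_gt0 // andbT).
have [K2 hK2] := @eventually_expR_le (c / (2 * D%:R)) (th * expR (- (D%:R * (ln 2 + 1))))
  ltac:(by rewrite divr_gt0 // mulr_gt0) ltac:(by rewrite mulr_gt0 // expR_gt0).
have [K3 hK3] := @eventually_expR_le 1 (e0 / 2) ltr01 ltac:(by rewrite divr_gt0).
exists (Num.max K1 (Num.max K2 K3)).
move=> V G k d lam p cV k0 regG connG lamd dV clam; rewrite !ge_max.
set n : R := #|V|%:R in clam *; set l := ln n.
move=> /and3P[/hK1 y1 /hK2 y2 /hK3 y3] p0 p1 pd.
rewrite mul1r in y3.
have kR : 1 <= (k%:R : R) by rewrite ler1n.
have nE : n = k%:R + 1 by rewrite /n cV -addn1 natrD.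
have n1 : 1 <= n by lra.
have l0 : 0 <= l by rewrite ln_ge0.
have lam0 : 0 < (lam%:R : R) by apply: lt_le_trans clam; rewrite mulr_gt0 //; lra.
have lamdR : (lam%:R : R) <= d%:R by rewrite ler_nat.
have d0 : 0 < (d%:R : R) by exact: lt_le_trans lamdR.
have dn : (d%:R : R) <= n by rewrite ler_nat.
have cd : c * d%:R <= lam%:R by apply: le_trans clam; rewrite ler_pM2l.
pose y := th^-1 * expR (- (eps / 8 * l)).
have yle : y <= Num.min 2^-1 (e0 / 4) by rewrite /y ler_pdivrMl.
have y0 : 0 <= y by rewrite mulr_ge0 ?expR_ge0 // invr_ge0 ltW.
move: yle; rewrite le_min => /andP[yle1 yle2].
pose T := expR (- ((ln 2 + 1) * n)).
have inner (J : {set 'I_k}) : (0 < #|J| <= k - k %/ D)%N ->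
   \sum_(F : {set {set V}} | (F \subset edges G) && (#|F| < #|J|)%N)
     prob (edges G) p (forest_event G J F) <= (y / n) ^+ #|J| + T.
  move=> /andP[J0 Jm0]; set m := #|J| in J0 Jm0 *.
  have m0 : 0 < (m%:R : R) by rewrite ltr0n.
  pose q := p * m%:R / k%:R.
  have qd : q * d%:R = (2 + eps) * l * m%:R / k%:R.
    by rewrite -pd /q; ring.
  have q0 : 0 <= q by rewrite divr_ge0 ?mulr_ge0 //; lra.
  have qle : th * q * (#|V| * d)%:R <= 2 * th * (2 + eps) * (l * m%:R).
    have -> : th * q * (#|V| * d)%:R = th * (q * d%:R) * n by rewrite natrM -/n; ring.
    rewrite qd.
    have -> : th * ((2 + eps) * l * m%:R / k%:R) * n = th * (2 + eps) * (l * m%:R) * (n / k%:R) by ring.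
    have -> : 2 * th * (2 + eps) * (l * m%:R) = th * (2 + eps) * (l * m%:R) * 2 by ring.
    rewrite ler_wpM2l //; first by rewrite !mulr_ge0 ?(ltW th0) ?(ltW m0) //; lra.
    by rewrite ler_pdivrMr; lra.
  have lm0 : 0 <= l * m%:R by rewrite mulr_ge0 // ltW.
  have [mD|mD] := leqP (m * D) #|V|.
    apply: (@le_trans _ _ ((y / n) ^+ m)); last by rewrite lerDl expR_ge0.
    have he (F : {set {set V}}) : F \subset edges G -> (#|F| < #|J|)%N ->
       (n - 2 * m%:R) * d%:R / 2 <= #|crossing (edges G) (components F)|%:R.
      move=> FE FJ; have := crossing_ge_isolated regG FE; rewrite -(ler_nat R) !natrM => h.
      rewrite ler_pdivrMr // [_ * 2]mulrC (le_trans _ h) // ler_wpM2r //.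
      rewrite lerBlDr /n -natrM -natrD ler_nat.
      by rewrite addnC -leq_subLR leq_sub2l // leq_mul2l ltnW.
    have := forest_sum_le p0 p1 k0 regG th0 th1 he.
    rewrite /= -/m -/q => /le_trans; apply.
    (* The exponent exceeds 1 by [eps / 4]: of this [eps / 8] goes to the choice of [F] and
       [eps / 8] remains in [y]. *)
    have qe : (1 + eps / 4) * (l * m%:R) <= q * ((n - 2 * m%:R) * d%:R / 2).
      have -> : q * ((n - 2 * m%:R) * d%:R / 2) = (q * d%:R) * (n - 2 * m%:R) / 2 by ring.
      rewrite qd.
      have -> : (2 + eps) * l * m%:R / k%:R * (n - 2 * m%:R) / 2 =
         ((2 + eps) / 2 * ((n - 2 * m%:R) / k%:R)) * (l * m%:R) by ring.
      rewrite ler_wpM2r //.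
      have mDR : m%:R * D%:R <= n by rewrite -natrM ler_nat.
      have h1 : (1 - 2 / D%:R) * n <= n - 2 * m%:R.
        have : m%:R <= n / D%:R by rewrite ler_pdivlMr.
        have -> : (1 - 2 / D%:R) * n = n - 2 * (n / D%:R) by ring.
        by lra.
      have h2 : 1 - 2 / D%:R <= (n - 2 * m%:R) / k%:R.
        have D2 : 0 <= 1 - 2 / (D%:R : R).
          by rewrite subr_ge0 ler_pdivrMr // mul1r; nra.
        rewrite ler_pdivlMr; last by lra.
        by apply: le_trans h1; rewrite ler_wpM2l //; lra.
      have h3 : 1 + eps / 4 <= (2 + eps) / 2 * (1 - 2 / D%:R).
        have : (8 + 4 * eps) / D%:R <= eps by rewrite ler_pdivrMr.
        by move: (D%:R^-1) => u; lra.
      by apply: le_trans h3 _; rewrite ler_wpM2l //; lra.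
    rewrite /y -[X in _ <= X ^+ _]mulrA exprMn ler_wpM2l ?exprn_ge0 ?invr_ge0 ?(ltW th0) //.
    have -> : expR (- (eps / 8 * l)) / n = expR (- (eps / 8 * l) - l).
      by rewrite expRD expRN [expR (- l)]expRN lnK // posrE; lra.
    rewrite -expRM_natl ler_expR.
    have := ler_wpM2r lm0 the; move: qe qle; move: (q * _) (th * q * _) => u v.
    have -> : m%:R * (- (eps / 8 * l) - l) = - (eps / 8 + 1) * (l * m%:R) by ring.
        by lra.
  apply: (@le_trans _ _ T); last by rewrite lerDr exprn_ge0 // divr_ge0 //; lra.
  have he (F : {set {set V}}) : F \subset edges G -> (#|F| < #|J|)%N ->
     (n - m%:R) * lam%:R / 2 <= #|crossing (edges G) (components F)|%:R.
    move=> FE FJ.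
    have F2 : (#|F|.+1 < #|V|)%N.
      by rewrite cV ltnS; apply: leq_trans FJ (leq_trans Jm0 (leq_subr _ _)).
    have := crossing_ge_connectivity connG F2; rewrite -(ler_nat R) !natrM => h.
    rewrite ler_pdivrMr // [_ * 2]mulrC (le_trans _ h) // ler_wpM2r //.
    rewrite lerBlDr /n -natrD ler_nat.
    by rewrite addnC -leq_subLR leq_sub2l // ltnW.
  have := forest_sum_le p0 p1 k0 regG th0 th1 he.
  rewrite /= -/m -/q => /le_trans; apply.
  have qe : c / D%:R * (l * m%:R) <= q * ((n - m%:R) * lam%:R / 2).
    (* As [n] is [k + 1], the difference is at least [(k %/ D).+1], which makes up for the rounded
       division. *)
    have nm : k%:R / D%:R <= n - m%:R.
      apply: (@le_trans _ _ (k %/ D).+1%:R).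
        by rewrite ler_pdivrMr // -natrM ler_nat ltnW // ltn_ceil.
      rewrite lerBrDr /n -natrD ler_nat cV addSn ltnS -leq_subRL //.
      exact: leq_div.
    have -> : q * ((n - m%:R) * lam%:R / 2) = (q * d%:R) * (lam%:R / d%:R) * (n - m%:R) / 2.
      by field; rewrite gt_eqF.
    rewrite qd.
    have -> : (2 + eps) * l * m%:R / k%:R * (lam%:R / d%:R) * (n - m%:R) / 2 =
       (lam%:R / d%:R) * ((n - m%:R) / k%:R) * ((2 + eps) / 2) * (l * m%:R) by ring.
    rewrite ler_wpM2r //.
    have h1 : c <= lam%:R / d%:R by rewrite ler_pdivlMr.
    have h2 : D%:R^-1 <= (n - m%:R) / k%:R.
      by rewrite ler_pdivlMr ?(lt_le_trans ltr01) // mulrC.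
    have h3 : 1 <= (2 + eps) / 2 by lra.
    rewrite -[X in X <= _]mulr1 ler_pM // ?mulr_ge0 ?invr_ge0 ?(ltW c0) ?(ltW D0) //.
    by rewrite ler_pM ?invr_ge0 ?(ltW c0) ?(ltW D0).
  (* Since [m * D > n], the [m]-th power of a base at most [expR (- (D%:R * (ln 2 + 1)))] is at most
     [T]. *)
  have zT : (th^-1 * expR (- (c / (2 * D%:R) * l))) ^+ m <= T.
    apply: (@le_trans _ _ (expR (- (D%:R * (ln 2 + 1))) ^+ m)).
      rewrite lerXn2r ?nnegrE ?expR_ge0 ?mulr_ge0 ?invr_ge0 ?(ltW th0) //.
      by rewrite ler_pdivrMl.
    rewrite -expRM_natl ler_expR mulrN lerN2 mulrA [X in _ <= X]mulrC ler_wpM2l //.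
      exact: addr_ge0.
    by rewrite -natrM ler_nat ltnW.
  apply: le_trans zT; rewrite exprMn ler_wpM2l ?exprn_ge0 ?invr_ge0 ?(ltW th0) //.
  rewrite -expRM_natl ler_expR.
  have := ler_wpM2r lm0 thc; move: qe qle; move: (q * _) (th * q * _) => u v.
  have -> : c / (2 * D%:R) = c / D%:R / 2 by rewrite invfM; ring.
  have -> : m%:R * - (c / D%:R / 2 * l) = - (c / D%:R / 2) * (l * m%:R) by ring.
  by lra.
rewrite -(pair_big_dep (fun J : {set 'I_k} => 0 < #|J| <= k - k %/ D)%N
   (fun (J : {set 'I_k}) (F : {set {set V}}) => (F \subset edges G) && (#|F| < #|J|)%N)
   (fun (J : {set 'I_k}) (F : {set {set V}}) => prob (edges G) p (forest_event G J F))) /=.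
apply: le_trans (ler_sum _ inner) _.
rewrite big_split /= (_ : e0 = e0 / 2 + e0 / 2); last by lra.
apply: lerD.
  have yn0 : 0 <= y / n by rewrite divr_ge0 //; lra.
  rewrite (eq_bigr (fun J : {set 'I_k} => \prod_(i in J) (y / n))); last by move=> J _; rewrite prodr_const.
  apply: le_trans (sum_nonempty_prod_le (fun=> yn0) _) _; first by move=> J /andP[].
  have h1 : \sum_(i : 'I_k) y / n <= y.
    rewrite sumr_const card_ord -[X in X <= _]mulr_natr mulrAC ler_pdivrMr; last by lra.
    by rewrite ler_wpM2l //; lra.
  apply: (@le_trans _ _ (expR y - 1)); first by rewrite lerD2r ler_expR.
  by apply: le_trans (expR_sub1_le yle1 y0) _; lra.
apply: (@le_trans _ _ (\sum_(J : {set 'I_k}) T)).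
  by rewrite [X in X <= _]big_mkcond; apply: ler_sum => J _; case: ifP => // _; exact: expR_ge0.
rewrite sumr_const -(finset.cardsT {set 'I_k}) -finset.powersetT card_powerset.
rewrite finset.cardsT card_ord -[X in X <= _]mulr_natl natrX -[X in X ^+ _](@lnK R 2) ?posrE //.
rewrite -expRM_natl -expRD.
apply: le_trans y3; rewrite ler_expR.
have : l < n by rewrite ln_sublinear //; lra.
have : k%:R * ln 2 <= n * ln 2 by rewrite ler_wpM2r //; lra.
by lra.
Qed.
End Asymptotics.

(** * Combining the two regimes and passing to the limit *)

Import numFieldNormedType.Exports.
Local Open Scope classical_set_scope.
Local Open Scope ring_scope.

Lemma Pr_rainbow_spanning_tree_ge (R : realType) (c eps e : R) :
  0 < c -> 0 < eps -> 0 < e ->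
  exists K : R, forall (V : finType) (G : sgraph V) (k d lam : nat),
  #|V| = k.+1 -> (0 < k)%N -> regular G d -> edge_connected G lam ->
  (lam <= d)%N -> c * #|V|%:R <= lam%:R -> K <= ln #|V|%:R ->
  1 - e <= Pr_colored_Gp G ((2 + eps) * ln #|V|%:R / d%:R)
    (fun H (f : coloring H k) => has_rainbow_spanning_tree f) <= 1.
Proof.
move=> c0 eps0 e0.
(* This [D] gives [(2 + eps) / 2 * (1 - 2 / D) >= 1 + eps / 4], so both regimes keep an exponent
   above 1. *)
have [D] := exists_nat_ge ((8 + 4 * eps) / eps); rewrite ler_pdivrMr // [X in _ <= X]mulrC => hD.
have D1 : 1 <= (D%:R : R) by nra.
have D0 : 0 < (D%:R : R) by lra.
(* Then [D%:R * Z] is at most 1/2 and at most [e / 4], so [expR (D%:R * Z) - 1] is at most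
   [e / 2]. *)
pose e1 := Num.min 2^-1 (e / 4) / D%:R.
have m0 : 0 < Num.min 2^-1 (e / 4) by rewrite lt_min invr_gt0 divr_gt0 // andbT.
have e10 : 0 < e1 by rewrite divr_gt0.
have [K1 hK1] := @sum_cut_le R c (1 + eps / 4) e1 c0 ltac:(lra) e10.
have [K2 hK2] := @forest_regime_le R c eps (e / 2) D c0 eps0 ltac:(by rewrite divr_gt0) hD.
exists (Num.max K1 (Num.max K2 (4 * (2 + eps) / c))).
move=> V G k d lam cV k0 regG connG lamd clam; rewrite !ge_max => /and3P[l1 l2].
have V0 : (0 < #|V|)%N by rewrite cV.
have dV : (d <= #|V|)%N.
  have /card_gt0P[x _] := V0.
  by rewrite -(card_incident regG x) max_card.
have sums := hK1 V G d lam regG connG lamd dV V0 clam l1.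
rewrite ler_pdivrMr // => l3.
set n : R := #|V|%:R in clam l3 sums *; set l := ln n in l3 sums *.
have nR : 1 <= n by rewrite ler1n.
have l0 : 0 <= l by rewrite ln_ge0.
have lam0 : 0 < (lam%:R : R) by apply: lt_le_trans clam; rewrite mulr_gt0 //; lra.
have lamdR : (lam%:R : R) <= d%:R by rewrite ler_nat.
have d0 : 0 < (d%:R : R) by exact: lt_le_trans lamdR.
set p := (2 + eps) * l / d%:R.
have pd : p * d%:R = (2 + eps) * l by rewrite /p mulfVK // gt_eqF.
have p0 : 0 <= p by rewrite /p divr_ge0 ?mulr_ge0 ?(ltW d0) //; lra.
have p1 : p <= 1.
  rewrite /p ler_pdivrMr // mul1r.
  (* With [x = expR (l / 2)], one has [n = x * x] and [x >= 1 + l / 2]. *)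
  have h : l * l <= 4 * n.
    have nE : n = expR (l / 2) * expR (l / 2).
      by rewrite -expRD -splitr lnK // posrE; lra.
    have := expR_ge1Dx (l / 2); rewrite nE; move: (expR _) => x hx; nra.
  have : (2 + eps) * l <= c * n by nra.
  by move=> /le_trans; apply; exact: le_trans lamdR.
have /andP[lo hi] := @Pr_colored_Gp_bounds R V G p k p0 p1 k0 cV.
rewrite hi andbT; apply: le_trans lo; rewrite lerD2l lerN2.
apply: le_trans (@prob_lacks_rainbow_basis_le R V G p k p0 p1 k0 cV (k - k %/ D)) _.
rewrite (_ : e = e / 2 + e / 2); last by lra.
apply: lerD; first exact: (hK2 V G k d lam p).
have kR : 0 < (k%:R : R) by rewrite ltr0n.
have D0' : (0 < D)%N by rewrite -(ltr0n R).
have kap : (k %/ D)%:R / k%:R <= (D%:R : R)^-1.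
  rewrite ler_pdivrMr // mulrC ler_pdivlMr // -natrM ler_nat.
  exact: leq_divM.
rewrite subKn ?leq_div //.
(* At most [k %/ D] colors occur on the crossing edges; the weight [th = 1 / D] costs a factor [D]
   per part. *)
apply: le_trans (@partition_regime_le R V G p k p0 p1 k0 (k %/ D) (D%:R^-1)
  ((1 + eps / 4) * l / d%:R) _ _ _ _ _) _.
- by rewrite invr_gt0.
- by rewrite invf_le1.
- exact: leq_div.
- by rewrite divr_ge0 ?mulr_ge0 ?(ltW d0) //; lra.
- have h3 : 1 + eps / 4 <= (2 + eps) / 2 * (1 - 2 / D%:R).
    have : (8 + 4 * eps) / D%:R <= eps by rewrite ler_pdivrMr.
    by move: (D%:R^-1) => u; lra.
  have h4 : (2 + eps) / 2 * (1 - 2 / D%:R) <= (2 + eps) / 2 * (1 - (k %/ D)%:R / k%:R - D%:R^-1).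
    by rewrite ler_wpM2l //; lra.
  have -> : p * (1 - (k %/ D)%:R / k%:R - D%:R^-1) / 2 =
    (2 + eps) / 2 * (1 - (k %/ D)%:R / k%:R - D%:R^-1) * (l / d%:R) by rewrite /p; ring.
  rewrite -mulrA ler_wpM2r ?divr_ge0 ?(ltW d0) //.
  exact: le_trans h4.
rewrite invrK; set Z := \sum_(A | _) _ in sums *.
have Z0 : 0 <= Z by apply: sumr_ge0 => A _; exact: expR_ge0.
have DZ0 : 0 <= D%:R * Z by rewrite mulr_ge0 // ltW.
have : D%:R * Z <= Num.min 2^-1 (e / 4) by rewrite mulrC -ler_pdivlMr.
rewrite le_min => /andP[z1 z2].
by apply: le_trans (expR_sub1_le z1 DZ0) _; lra.
Qed.

Theorem theorem1p1 (R : realType) (eps c : R) (heps : 0 < eps) (hc : 0 < c)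
  (N : set nat) (N_pos : forall n, N n -> (0 < n)%N) (N_inf : infinite_set N)
  (V : nat -> finType) (G : forall n : nat, sgraph (V n))
  (d lam : nat -> nat)
  (hV : forall n, N n -> #|V n| = n)
  (hreg : forall n, N n -> regular (G n) (d n))
  (hconn : forall n, N n -> edge_connected (G n) (lam n))
  (hdlam : forall n, N n -> (lam n <= d n)%N)
  (hlam : forall n, N n -> c * n%:R <= (lam n)%:R) :
  Pr_colored_Gp (G n) ((2 + eps) * ln n%:R / (d n)%:R)
    (fun H (f : coloring H n.-1) => has_rainbow_spanning_tree f)
    @[n --> within N \oo] --> (1 : R).
Proof.
apply/cvgrPdist_le => e e0.
have [K hK] := @Pr_rainbow_spanning_tree_ge R c eps e hc heps e0.
have [M hM] := exists_nat_ge (expR K).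
(* [2 <= n] makes the number [n.-1] of colors positive, and [M <= n] gives [K <= ln n]. *)
rewrite near_withinE; exists (maxn 2 M) => // n /=; rewrite geq_max => /andP[n2 Mn] Nn.
have n1 : n = n.-1.+1 by rewrite prednK // ltnW.
have := hK (V n) (G n) n.-1 (d n) (lam n).
rewrite hV // => /(_ n1).
have -> : (0 < n.-1)%N by rewrite -ltnS -n1.
move=> /(_ isT (hreg n Nn) (hconn n Nn) (hdlam n Nn) (hlam n Nn)).
have Kn : K <= ln n%:R.
  rewrite -ler_expR lnK ?posrE ?ltr0n ?(ltnW n2) //.
  by apply: le_trans hM _; rewrite ler_nat.
move=> /(_ Kn) /andP[lo hi].
by rewrite ger0_norm ?subr_ge0 // lerBlDl -lerBlDr.
Qed.
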